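(* There is a positive integer $k_0$ such that the $SL(2,\mathbb{R})$-cocycle $(T,A)$ over the left shift $T$ on $X=\{0,1\}^{\mathbb{Z}}$ defined by $$A(x)=\begin{pmatrix}2&0\\0&1/2\end{pmatrix}R_{\theta(x)},\qquad \theta(x)=\begin{cases}\pi/2&\text{if }x=q,\\ \pi/2-2^{-k(x)/8}&\text{if }x\in V\setminus\{q\}\text{ and }k(x)>k_0,\\ 0&\text{otherwise,}\end{cases}$$ where $q$ is the sequence with $q_0=1$ and $q_n=0$ for $n\neq0$, $V=\{x\in X:x_0=1\}$ and $k(x)=\min\{|n|: n\ne0,\ x_n=1\}$, has the following properties: 1. The cocycle $(T,A)$ is not uniformly hyperbolic. 2. There is a full probability set $\mathcal{S}$ such that $\lambda_+(x)\ge \frac{\log 2}{2}>0$ for every $x\in\mathcal{S}$.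
   Context: $X=\{0,1\}^{\mathbb{Z}}$ carries the metric $d(x,y)=2^{-N(x,y)}$ for $x\neq y$, where $N(x,y)=\min\{|n|\ge 0:x_n\ne y_n\}$, and $d(x,x)=0$; $T((x_n)_{n\in\mathbb{Z}})=(x_{n+1})_{n\in\mathbb{Z}}$. $R_\theta$ is the rotation of $\mathbb{R}^2$ by angle $\theta$. The function $k(x)$ is finite for every $x\in V\setminus\{q\}$. A linear cocycle is a pair $(T,A)$ with $T$ a homeomorphism of a compact metric space $X$ and $A:X\to GL(d,\mathbb{R})$ continuous; it is an $SL(2,\mathbb{R})$-cocycle if $A$ takes values in $SL(2,\mathbb{R})$. For $n>0$, $A^n(x):=A(T^{n-1}x)\cdots A(Tx)A(x)$ and $A^{-n}(x):=A(T^{-n}x)^{-1}A(T^{-n+1}x)^{-1}\cdots A(T^{-1}x)^{-1}$. $\|\cdot\|$ is the Euclidean norm and the induced operator norm. An $SL(2,\mathbb{R})$-cocycle $(T,A)$ is uniformly hyperbolic if there are constants $c>0$ and $0<\lambda<1$ such that for every $x\in X$ there exist transverse one-dimensional subspaces $E^s_x,E^u_x$ of $\mathbb{R}^2$ with (1) $A(x)E^s_x=E^s_{T(x)}$ and $A(x)E^u_x=E^u_{T(x)}$; (2) $\|A^n(x)v^s\|\le c\lambda^n\|v^s\|$ and $\|A^{-n}(x)v^u\|\le c\lambda^n\|v^u\|$ for every $x\in X$, $v^s\in E^s_x$, $v^u\in E^u_x$, $n\ge1$. $\lambda_+(x):=\lim_{n\to\infty}\frac1n\log\|A^n(x)\|$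 whenever the limit exists (in the claim, existence of the limit at every point of $\mathcal{S}$ is part of the statement). A Borel set $\mathcal{S}\subset X$ is a full probability set if $\mu(\mathcal{S})=1$ for every $T$-invariant Borel probability measure $\mu$. *)

(* Defs.v *)
From HB Require Import structures.
From mathcomp Require Import all_boot all_order all_algebra.
From mathcomp Require Import all_classical all_reals all_analysis.

Set Implicit Arguments.
Unset Strict Implicit.
Unset Printing Implicit Defensive.

Import Order.TTheory GRing.Theory Num.Theory.
Import numFieldNormedType.Exports.

Local Open Scope classical_set_scope.
Local Open Scope ring_scope.

(* Minimum of a set of natural numbers; the junk value for the empty set is 0. *)
Definition natmin (S : set nat) : nat :=
  if pselect (exists n, `[< S n >]) is left S0 then ex_minn S0 else 0%N.

Lemma natminP (S : set nat) : S !=set0 ->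
  S (natmin S) /\ forall n, S n -> (natmin S <= n)%N.
Proof.
move=> [m Sm]; rewrite /natmin; case: pselect => [S0|[]]; last first.
  by exists m; apply/asboolP.
case: ex_minnP => n /asboolP Sn minn; split=> // k Sk.
by apply: minn; apply/asboolP.
Qed.

Section cocycles.
Variable R : realType.

Definition enorm d (v : 'cV[R]_d) : R := Num.sqrt (\sum_i v i 0 ^+ 2).

Definition opnorm d (M : 'M[R]_d) : R :=
  sup [set enorm (M *m v) | v in [set v | enorm v <= 1]].

(* [T'] is the inverse of [T]. *)
Definition homeomorphism (X : topologicalType) (T T' : X -> X) : Prop :=
  [/\ continuous T, continuous T', cancel T T' & cancel T' T].

Definition linear_cocycle d (X : metricType R) (T T' : X -> X)
    (A : X -> 'M[R]_d) : Prop :=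
  [/\ compact [set: X], homeomorphism T T', continuous A
    & forall x, A x \in unitmx].

Definition SL2_cocycle (X : metricType R) (T T' : X -> X)
    (A : X -> 'M[R]_2) : Prop :=
  linear_cocycle T T' A /\ forall x, \det (A x) = 1.

Section iterates.
Variables (X : Type) (d : nat) (T T' : X -> X) (A : X -> 'M[R]_d).

(* A(T^(n-1) x) ... A(T x) A(x) *)
Fixpoint cocycle_pow (n : nat) (x : X) : 'M[R]_d :=
  if n is m.+1 then A (iter m T x) *m cocycle_pow m x else 1%:M.

(* A(T^(-n) x)^-1 ... A(T^(-1) x)^-1 *)
Fixpoint cocycle_negpow (n : nat) (x : X) : 'M[R]_d :=
  if n is m.+1 then invmx (A (iter m.+1 T' x)) *m cocycle_negpow m x
  else 1%:M.

End iterates.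

Definition uniformly_hyperbolic (X : metricType R) (T T' : X -> X)
    (A : X -> 'M[R]_2) : Prop :=
  exists c lambda : R, [/\ 0 < c, 0 < lambda, lambda < 1 &
  exists Es Eu : X -> {vspace 'cV[R]_2},
  [/\ forall x, [/\ \dim (Es x) = 1%N, \dim (Eu x) = 1%N
                  & (Es x :&: Eu x = 0)%VS],
      forall x, (linfun (mulmx (A x)) @: Es x)%VS = Es (T x) /\
                (linfun (mulmx (A x)) @: Eu x)%VS = Eu (T x)
    & forall x (vs vu : 'cV[R]_2) (n : nat),
        vs \in Es x -> vu \in Eu x -> (1 <= n)%N ->
        enorm (cocycle_pow T A n x *m vs) <= c * lambda ^+ n * enorm vs /\
        enorm (cocycle_negpow T' A n x *m vu) <= c * lambda ^+ n * enorm vu]].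

(* The term of index 0 is 0, because x / 0 = 0. *)
Definition lyapunov_seq (X : Type) d (T : X -> X) (A : X -> 'M[R]_d) (x : X)
    : R^nat :=
  fun n => ln (opnorm (cocycle_pow T A n x)) / n%:R.

Definition lyapunov_exponent (X : Type) d (T : X -> X) (A : X -> 'M[R]_d)
    (x : X) : R :=
  limn (lyapunov_seq T A x).

(* The Borel sigma-algebra; the library wants a pointed carrier for it. *)
Definition borel_of (X : ptopologicalType) := g_sigma_algebraType (@open X).

Definition full_probability (X : ptopologicalType) (T : X -> X)
    (S : set X) : Prop :=
  measurable (S : set (borel_of X)) /\
  forall mu : probability (borel_of X) R,
    (forall B : set (borel_of X), measurable B -> mu (T @^-1` B) = mu B) ->
    mu S = 1%E.

End cocycles.
Arguments full_probability R {X} T S.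

(* {0,1}^Z; the phantom parameter [R] is the field in which the metric takes
   its values. *)
Definition fullshift (R : realType) : Type := int -> bool.

Section fullshift.
Variable R : realType.
Local Notation X := (fullshift R).
Implicit Types x y z : X.

Definition diffset x y : set nat :=
  [set m | exists n : int, x n != y n /\ `|n|%N = m].

Definition shift_dist x y : R :=
  if `[< x = y >] then 0 else 2 ^- natmin (diffset x y).

Lemma diffset0 x y : x <> y -> diffset x y !=set0.
Proof.
move=> xy; apply: contrapT => /forallNP h; apply: xy; apply/funext => n.
by apply/eqP; apply: contrapT => /negP xyn; apply: (h `|n|%N); exists n.
Qed.

Lemma shift_distxx x : shift_dist x x = 0.
Proof. by rewrite /shift_dist asboolT. Qed.

Lemma shift_dist_ge0 x y : 0 <= shift_dist x y.
Proof. by rewrite /shift_dist; case: ifP => // _; rewrite invr_ge0 exprn_ge0. Qed.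

Lemma shift_dist_positivity x y : shift_dist x y = 0 -> x = y.
Proof.
rewrite /shift_dist; case: asboolP => // _ /eqP.
by rewrite invr_eq0 expf_eq0 pnatr_eq0 andbF.
Qed.

Lemma shift_dist_sym x y : shift_dist x y = shift_dist y x.
Proof.
rewrite /shift_dist (_ : diffset x y = diffset y x).
  by congr (if _ then _ else _); apply/asboolP/asboolP.
by apply/seteqP; split=> m [n [xy nm]]; exists n; rewrite eq_sym.
Qed.

Lemma shift_dist_ge x y (n : int) : x n != y n -> 2 ^- `|n|%N <= shift_dist x y.
Proof.
move=> xyn; have xy : x <> y by move=> xy; rewrite xy eqxx in xyn.
rewrite /shift_dist asboolF// lef_pV2 ?posrE ?exprn_gt0// ler_eXn2l ?ltr1n//.
by apply: (natminP (diffset0 xy)).2; exists n.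
Qed.

Lemma shift_dist_triangle y x z :
  shift_dist x z <= shift_dist x y + shift_dist y z.
Proof.
have [->|xz] := pselect (x = z).
  by rewrite shift_distxx addr_ge0 ?shift_dist_ge0.
rewrite {1}/shift_dist asboolF//.
have [[n [xzn <-]] _] := natminP (diffset0 xz).
have [xyn|xyn] := eqVneq (x n) (y n).
  apply: (le_trans (y := shift_dist y z)); first by rewrite shift_dist_ge// -xyn.
  by rewrite lerDr shift_dist_ge0.
by rewrite (le_trans (shift_dist_ge xyn))// lerDl shift_dist_ge0.
Qed.

HB.instance Definition _ := gen_eqMixin X.
HB.instance Definition _ := gen_choiceMixin X.
HB.instance Definition _ := isPointed.Build X (fun=> false).
HB.instance Definition _ := @isMetric.Build R X shift_dist
  shift_distxx shift_dist_positivity shift_dist_sym shift_dist_triangle.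

Definition shift_map x : X := fun n => x (n + 1).
Definition shift_map_inv x : X := fun n => x (n - 1).

Definition q : X := fun n => n == 0.

Definition V : set X := [set x | x 0].

(* Only meaningful for x != q in V; the set is empty, hence k(q) = 0, at q. *)
Definition k x : nat :=
  natmin [set m | exists n : int, [/\ n != 0, x n & `|n|%N = m]].

Definition theta (k0 : nat) x : R :=
  if `[< x = q >] then pi / 2
  else if `[< V x /\ (k0 < k x)%N >] then pi / 2 - 2 `^ (- (k x)%:R / 8)
  else 0.

Definition mx2 (a b c d : R) : 'M[R]_2 :=
  \matrix_(i < 2, j < 2)
    if i == 0 then (if j == 0 then a else b) else (if j == 0 then c else d).

Definition rotation (t : R) : 'M[R]_2 := mx2 (cos t) (- sin t) (sin t) (cos t).

Definition shift_cocycle (k0 : nat) x : 'M[R]_2 :=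
  mx2 2 0 0 2^-1 *m rotation (theta k0 x).

End fullshift.

(* Main.v *)
Require Import Defs.
From HB Require Import structures.
From mathcomp Require Import all_boot all_order all_algebra.
From mathcomp Require Import all_classical all_reals all_analysis.
From mathcomp Require Import measurable_realfun zify ring lra.

Set Implicit Arguments.
Unset Strict Implicit.
Unset Printing Implicit Defensive.

Import Order.TTheory GRing.Theory Num.Theory.
Import numFieldNormedType.Exports.

Local Open Scope classical_set_scope.
Local Open Scope ring_scope.

(** Let D be the diagonal matrix with entries 2 and 1/2. The cocycle equals D
at the points of {0,1}^Z whose central symbol is 0. At a point of V whose next
nearest one lies at distance k > 8, it is D after a rotation which misses the
quarter turn by e = 2^(-k/8); at [q] it is D after the quarter turn.

Hyperbolicity fails along the orbit of [q]. This orbit meets V only at [q], so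
the contraction estimates force the stable line at T q to be vertical and the
unstable line at [q] to be horizontal. The quarter turn at [q] carries the
second onto the first, and transversality is lost at T q
([not_uniformly_hyperbolic]).

The exponent stays large because the definition of k leaves room on both sides
of a rotation. A nearly horizontal vector arrives at a rotation of parameter k
after at least k steps of D, so its vertical part is at most 2^-k times its
horizontal part, far below e. The rotation makes it nearly vertical, but leaves
a horizontal part of relative size about e. The g >= k steps of D that follow
multiply this part by 2^g, so that between two consecutive ones the horizontal
part grows by at least 2^(g - k/8 - 2) >= 2^(g/2), and the vector is nearly
horizontal again ([cone_return]). Chaining the visits to V gives, at every
point x of the space, a vector whose image under A^n(x) has size at least
2^((n - p)/2) for arbitrarily large n ([growth]). Wherever the exponent exists,
it is therefore at least (ln 2)/2 ([lyapunov_exponent_ge]); no measure is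
involved in this bound.

It remains to see that the exponent exists almost everywhere for each invariant
probability measure, and the full probability set can be the set of all points
where it exists. The logarithm of the norm of A^n is subadditive along orbits,
so this is the existence part of Kingman's theorem ([subadditive_ergodic]). As
the value of the limit does not matter, it suffices to compare integrals: the
integral of the upper limit of f_n/n is at most that of the lower limit. Both
comparisons come from Steele's covering of orbit segments by pieces on which
f_n/n is almost optimal ([subadditive_cover], [subadditive_integral_le]),
applied once to f itself, and once, with the map tau^m, to C m j minus the
Birkhoff sum of f_m. *)

Lemma eventually_le_mul_nat (R : realType) (c e : R) : 0 < e ->
  exists N, forall n, (N <= n)%N -> c <= e * n%:R.
Proof.
move=> e0; exists (Num.bound (`|c| / e)) => n.
rewrite -(ler_nat R) => Nn.
have := archi_boundP (divr_ge0 (normr_ge0 c) (ltW e0)).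
rewrite ltr_pdivrMr// => cb; apply: le_trans (ler_norm c) _.
apply: le_trans (ltW cb) _; rewrite mulrC; exact: ler_wpM2l (ltW e0) _ _ Nn.
Qed.

(** * Integrals of bounded measurable functions *)

Section bounded_measurable.
Context d (T : measurableType d) (R : realType) (P : probability T R).
Implicit Types (f g : T -> R).

Definition bounded_measurable f :=
  measurable_fun [set: T] f /\ exists M, forall x, `|f x| <= M.

Lemma bounded_measurable_integrable f :
  bounded_measurable f -> P.-integrable [set: T] (EFin \o f).
Proof.
move=> [mf [M fM]]; apply: measurable_bounded_integrable => //.
  by rewrite (le_lt_trans (probability_le1 P measurableT)) ?ltry.
exists M; split; first exact: num_real.
by move=> B MB x _; exact: le_trans (fM x) (ltW MB).
Qed.

Lemma bounded_measurable_cst (c : R) : bounded_measurable (cst c).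
Proof. by split; [exact: measurable_cst|exists `|c|]. Qed.

Lemma bounded_measurableD f g : bounded_measurable f -> bounded_measurable g ->
  bounded_measurable (fun x => f x + g x).
Proof.
move=> [mf [M fM]] [mg [N gN]]; split; first exact: measurable_funD.
by exists (M + N) => x; apply: le_trans (ler_normD _ _) _; exact: lerD.
Qed.

Lemma bounded_measurableZ (c : R) f : bounded_measurable f ->
  bounded_measurable (fun x => c * f x).
Proof.
move=> [mf [M fM]]; split; first exact: measurable_funM.
by exists (`|c| * M) => x; rewrite normrM ler_wpM2l.
Qed.

Lemma bounded_measurableB f g : bounded_measurable f -> bounded_measurable g ->
  bounded_measurable (fun x => f x - g x).
Proof.
move=> bf bg; rewrite (_ : (fun x => _) = fun x => f x + -1 * g x).
  exact/bounded_measurableD/bounded_measurableZ.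
by apply/funext => x; rewrite mulN1r.
Qed.

Lemma bounded_measurable_sum (f : nat -> T -> R) n :
  (forall i, bounded_measurable (f i)) ->
  bounded_measurable (fun x => \sum_(i < n) f i x).
Proof.
move=> bf; elim: n => [|n IHn].
  rewrite (_ : (fun x => _) = cst 0); first exact: bounded_measurable_cst.
  by apply/funext => x; rewrite big_ord0.
under eq_fun do rewrite big_ord_recr /=.
exact: bounded_measurableD.
Qed.

Lemma bounded_measurable_indic (A : set T) : measurable A ->
  bounded_measurable (\1_A : T -> R).
Proof.
move=> mA; split; first exact: measurable_indic.
by exists 1 => x; rewrite indicE; case: (x \in A); rewrite ?normr1 ?normr0.
Qed.

Lemma Rintegral_sum (f : nat -> T -> R) n :
  (forall i, bounded_measurable (f i)) ->
  \int[P]_x (\sum_(i < n) f i x) = \sum_(i < n) \int[P]_x (f i x).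
Proof.
move=> bf; elim: n => [|n IHn].
  rewrite big_ord0; under eq_Rintegral do rewrite big_ord0.
  by rewrite Rintegral_cst// mul0r.
rewrite big_ord_recr /= -IHn -RintegralD//.
- by apply: eq_Rintegral => x _; rewrite big_ord_recr.
- exact/bounded_measurable_integrable/bounded_measurable_sum.
- exact: bounded_measurable_integrable.
Qed.

Lemma Rintegral_cst_probability (c : R) : \int[P]_x c = c.
Proof.
have P1 : (P : {measure set T -> \bar R}) setT = 1%E := probability_setT P.
by rewrite Rintegral_cst// P1 mulr1.
Qed.

Lemma Rintegral_indic (A : set T) : measurable A ->
  \int[P]_x (\1_A x : R) = fine (P A).
Proof. by move=> mA; rewrite /Rintegral integral_indic// setIT. Qed.

End bounded_measurable.

(** * Steele's covering argument *)

Section invariant.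
Context d (T : measurableType d) (R : realType) (P : probability T R).
Variable tau : T -> T.
Hypothesis mtau : measurable_fun [set: T] tau.
Hypothesis Ptau : forall B, measurable B -> P (tau @^-1` B) = P B.

Lemma measurable_iter n : measurable_fun [set: T] (iter n tau).
Proof. by elim: n => [|n IHn]; [exact: measurable_id|exact: measurableT_comp]. Qed.

Lemma invariant_iter n B : measurable B -> P (iter n tau @^-1` B) = P B.
Proof.
move=> mB; elim: n => [//|n IHn].
rewrite -IHn -[RHS]Ptau; last first.
  by rewrite -[X in measurable X]setTI; exact: measurable_iter.
by congr (P _); apply/funext => x; rewrite /preimage /= -iterSr.
Qed.

Lemma bounded_measurable_iter (f : T -> R) n :
  bounded_measurable f -> bounded_measurable (fun x => f (iter n tau x)).
Proof.
move=> [mf [M fM]]; split; last by exists M.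
by apply: (measurableT_comp mf); exact: measurable_iter.
Qed.

Lemma Rintegral_iter (f : T -> R) n : bounded_measurable f ->
  \int[P]_x (f (iter n tau x)) = \int[P]_x (f x).
Proof.
move=> bf; congr fine.
rewrite -[LHS](@integral_pushforward _ _ _ _ _ _ (measurable_iter n) P setT (EFin \o f))//.
- apply: eq_measure_integral => [|mt A mA _]; first exact: measurable_iter.
  by have := invariant_iter n mA.
- by apply/measurable_EFinP; case: bf.
- exact/bounded_measurable_integrable/bounded_measurable_iter.
Qed.

(** An orbit segment is cut into pieces from left to right. Off B a piece of
length n <= N costs at most g x * n, because g does not increase along the
orbit; a point of B is a piece of length one, which costs at most C; and the
last piece, once at most N steps remain, costs at most C * N. Subadditivity adds
the costs up. *)
Lemma subadditive_cover (f : nat -> T -> R) (C : R) (g : T -> R) (N : nat) (B : set T) :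
  (forall n x, 0 <= f n x <= C * n%:R) ->
  (forall m n x, f (m + n)%N x <= f m x + f n (iter m tau x)) ->
  (forall x, 0 <= g x) -> (forall x, g (tau x) <= g x) ->
  (forall x, ~ B x -> exists n, [/\ (0 < n)%N, (n <= N)%N & f n x <= g x * n%:R]) ->
  forall m x, f m x <= g x * m%:R + C * (\sum_(i < m) \1_B (iter i tau x)) + C * N%:R.
Proof.
move=> fC fD g0 gtau good m.
have C0 : 0 <= C by have /andP[+ +] := fC 1%N point; rewrite mulr1; exact: le_trans.
have gi i x : g (iter i tau x) <= g x.
  by elim: i => // i IHi; exact: le_trans (gtau _) IHi.
have one0 x : 0 <= \1_B x :> R by rewrite indicE.
have step n l x : f n x <= g x * n%:R + C * \sum_(i < n) \1_B (iter i tau x) ->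
    f l (iter n tau x) <= g (iter n tau x) * l%:R
      + C * (\sum_(i < l) \1_B (iter i tau (iter n tau x))) + C * N%:R ->
    f (n + l)%N x <= g x * (n + l)%N%:R
      + C * (\sum_(i < n + l) \1_B (iter i tau x)) + C * N%:R.
  move=> fn fl; apply: le_trans (fD _ _ _) _.
  rewrite big_split_ord /=.
  under [X in _ + C * (_ + X)]eq_bigr => i _ do rewrite addnC iterD.
  have := ler_wpM2r (ler0n R l) (gi n x).
  rewrite natrD; lra.
elim/ltn_ind: m => m IHm x.
have s0 n : 0 <= C * \sum_(i < n) \1_B (iter i tau x) :> R.
  by apply: mulr_ge0 => //; apply: sumr_ge0.
have [mN|Nm] := leqP m N.
  have /andP[_ /le_trans] := fC m x; apply.
  have := ler_wpM2l C0 (_ : m%:R <= N%:R); rewrite ler_nat => /(_ mN).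
  have := mulr_ge0 (g0 x) (ler0n R m); have := s0 m; lra.
have [Bx|/good[n [n0 nN fn]]] := pselect (B x).
  rewrite -(subnKC (leq_ltn_trans (leq0n N) Nm)); apply: step.
    rewrite big_ord_recl big_ord0 addr0 /= indicE mem_set// !mulr1.
    by have /andP[_] := fC 1%N x; have := g0 x; lra.
  by apply: IHm; lia.
rewrite -(subnKC (ltnW (leq_ltn_trans nN Nm))); apply: step.
  by have := s0 n; lra.
by apply: IHm; lia.
Qed.

(** The covering bound is integrated with B the set of points which need more
than N steps. As N grows these sets decrease to the empty set, and invariance of
the measure makes all their preimages equally small. The function g is only
required to be approached from above by some f n / n: this covers both a lower
limit and, after a change of sign, an upper limit. *)
Lemma subadditive_integral_le (f : nat -> T -> R) (C : R) (g : T -> R) :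
  (forall n, measurable_fun [set: T] (f n)) ->
  (forall n x, 0 <= f n x <= C * n%:R) ->
  (forall m n x, f (m + n)%N x <= f m x + f n (iter m tau x)) ->
  bounded_measurable g -> (forall x, 0 <= g x) -> (forall x, g (tau x) <= g x) ->
  (forall x e, 0 < e -> exists n, (0 < n)%N /\ f n x <= (g x + e) * n%:R) ->
  forall e, 0 < e ->
    exists m, (0 < m)%N /\ \int[P]_x (f m x) <= (\int[P]_x (g x) + e) * m%:R.
Proof.
move=> mf fC fD bg g0 gtau hfg e e0.
have C0 : 0 <= C by have /andP[+ +] := fC 1%N point; rewrite mulr1; exact: le_trans.
(* The error e is shared by the slack in g, the bad set and the last piece. *)
pose h x := g x + e / 3.
have bh : bounded_measurable h.
  by apply: bounded_measurableD => //; exact: bounded_measurable_cst.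
pose B N := \bigcap_(n in [set n | (0 < n <= N)%N]) [set x | h x * n%:R < f n x].
have mB N : measurable (B N).
  apply: bigcap_measurableType => n _.
  rewrite (_ : [set x | _] = setT `&` (fun x => h x * n%:R < f n x) @^-1` [set true]).
    apply: measurable_fun_ltr => //.
    by apply: measurable_funM => //; case: bh.
  by rewrite setTI; apply/seteqP; split.
have : P (B N) @[N --> \oo] --> P (\bigcap_N B N).
  apply: nonincreasing_cvg_mu => //.
  - by rewrite (le_lt_trans (probability_le1 _ _)) ?ltry.
  - exact: bigcap_measurable.
  - move=> m n mn; apply/subsetPset => x Bx k /= /andP[k0 km].
    by apply: Bx; rewrite /= k0 (leq_trans km).
have -> : \bigcap_N B N = set0.
  rewrite -subset0 => x Bx.
  have [n [n0]] := hfg x (e / 3) (divr_gt0 e0 (ltr0n _ 3)).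
  by rewrite leNgt (Bx n)//= n0 leqnn.
rewrite measure0 => /fine_cvg /cvgrPdist_lt.
have e1 : 0 < e / (3 * (C + 1)) by rewrite divr_gt0// mulr_gt0//; lra.
move=> /(_ _ e1) [N _ /(_ N (leqnn N))] /=; rewrite sub0r normrN ger0_norm ?fine_ge0// => PB.
pose m := (Num.bound (3 * C * N%:R / e)).+1.
exists m; split => //.
have hm : C * N%:R <= e / 3 * m%:R.
  have : 3 * C * N%:R / e < m%:R.
    rewrite (lt_le_trans (archi_boundP _))//; last by rewrite ler_nat.
    by rewrite divr_ge0 ?(ltW e0)// !mulr_ge0.
  rewrite ltr_pdivrMr// => ?; lra.
have bf n : bounded_measurable (f n).
  split=> //; exists (C * n%:R) => x; have /andP[? ?] := fC n x.
  by rewrite ger0_norm.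
have b1 i : bounded_measurable (fun x => \1_(B N) (iter i tau x) : R).
  exact/bounded_measurable_iter/bounded_measurable_indic.
have bs : bounded_measurable (fun x => \sum_(i < m) (\1_(B N) (iter i tau x) : R)).
  exact: (bounded_measurable_sum (f := fun i x => \1_(B N) (iter i tau x))).
have := @le_Rintegral _ _ _ P _ (f m)
  (fun x => m%:R * h x + C * (\sum_(i < m) \1_(B N) (iter i tau x)) + C * N%:R) measurableT.
have bmh := bounded_measurableZ m%:R bh.
have bCs := bounded_measurableZ C bs.
have bCN := @bounded_measurable_cst _ T R (C * N%:R).
have bmD := bounded_measurableD bmh bCs.
have ii := @bounded_measurable_integrable _ T R P.
have bge := @bounded_measurable_cst _ T R (e / 3).
move=> /(_ (ii _ (bf m)) (ii _ (bounded_measurableD bmD bCN))).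
rewrite (RintegralD measurableT (ii _ bmD) (ii _ bCN)).
rewrite (RintegralD measurableT (ii _ bmh) (ii _ bCs)).
rewrite (RintegralZl _ measurableT (ii _ bh)).
rewrite (RintegralZl _ measurableT (ii _ bs)).
rewrite (RintegralD measurableT (ii _ bg) (ii _ bge)) !Rintegral_cst_probability.
rewrite (Rintegral_sum P m b1).
have -> : \sum_(i < m) \int[P]_x (\1_(B N) (iter i tau x) : R) = fine (P (B N)) * m%:R.
  under eq_bigr => i _.
    rewrite (Rintegral_iter (f := \1_(B N))); last exact: bounded_measurable_indic.
    rewrite Rintegral_indic//; over.
  by rewrite sumr_const card_ord mulr_natr.
move=> H; apply: le_trans (H _) _ => [x _|].
  rewrite (mulrC m%:R); apply: (@subadditive_cover f C h N (B N)) => //.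
  - by move=> y; rewrite addr_ge0// divr_ge0// ltW.
  - by move=> y; rewrite lerD2r.
  - move=> y; apply: contra_notP => /forallNP nex n /= /andP[n0 nN].
    by rewrite /= ltNge; apply/negP => fn; apply: (nex n).
have hB : C * fine (P (B N)) <= e / 3.
  have : (C + 1) * fine (P (B N)) <= e / 3.
    rewrite mulrC -ler_pdivlMr; last lra.
    by rewrite -mulrA -invfM; exact: ltW.
  by have := fine_ge0 (measure_ge0 P (B N)); lra.
have := ler_wpM2r (ler0n R m) hB; lra.
Qed.

End invariant.

(** * Upper and lower limits of bounded sequences *)

Section upper_lower_limits.
Variable R : realType.
Implicit Types u v : R^nat.

Definition bounded_by (C : R) u := forall n, - C <= u n <= C.

Lemma bounded_byN C u : bounded_by C u -> bounded_by C (fun n => - u n).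
Proof. by move=> uC n; rewrite lerN2 lerNl andbC. Qed.

Lemma bounded_by_ubound C u : bounded_by C u -> has_ubound (range u).
Proof. by move=> uC; exists C => _ [n _ <-]; have /andP[] := uC n. Qed.

Lemma bounded_by_lbound C u : bounded_by C u -> has_lbound (range u).
Proof. by move=> uC; exists (- C) => _ [n _ <-]; have /andP[] := uC n. Qed.

Lemma limn_sup_eventually C u : bounded_by C u -> forall e, 0 < e ->
  exists N, forall n, (N <= n)%N -> u n <= limn_sup u + e.
Proof.
move=> uC e e0; have ub := bounded_by_ubound uC.
have := cvg_sups_inf ub (bounded_by_lbound uC).
move=> /[dup] /cvg_lim lE /cvgrPdist_lt /(_ e e0) [N _ Nu].
exists N => n Nn; rewrite /limn_sup lE//.
have := Nu n Nn; rewrite distrC => /ltr_distlDr /ltW; apply: le_trans.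
apply: ub_le_sup; last by exists n => /=.
exact: has_ubound_sdrop.
Qed.

Lemma limn_sup_frequently C u : bounded_by C u -> forall e, 0 < e ->
  forall N, exists n, (N <= n)%N /\ limn_sup u - e <= u n.
Proof.
move=> uC e e0 N; have ub := bounded_by_ubound uC.
have := cvg_sups_inf ub (bounded_by_lbound uC).
move=> /[dup] cu /cvg_lim lE.
have le_s : limn_sup u <= sups u N.
  rewrite /limn_sup; apply: nonincreasing_cvgn_ge; first exact: nonincreasing_sups.
  by apply/cvg_ex; eexists; exact: cu.
have hs : has_sup (sdrop u N).
  by split; [exists (u N); exists N => /=|exact: has_ubound_sdrop].
have [_ [n /= Nn <-] un] := sup_adherent e0 hs.
by exists n; split => //; rewrite (le_trans _ (ltW un))// lerB.
Qed.

(** The lower limit is written as the opposite of an upper limit, so that each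
fact about upper limits yields its dual. *)
Definition limn_low u := - limn_sup (fun n => - u n).

Lemma limn_low_eventually C u : bounded_by C u -> forall e, 0 < e ->
  exists N, forall n, (N <= n)%N -> limn_low u - e <= u n.
Proof.
move=> /bounded_byN uC e e0; have [N uN] := limn_sup_eventually uC e0.
by exists N => n /uN; rewrite /limn_low; lra.
Qed.

Lemma limn_low_frequently C u : bounded_by C u -> forall e, 0 < e ->
  forall N, exists n, (N <= n)%N /\ u n <= limn_low u + e.
Proof.
move=> /bounded_byN uC e e0 N; have [n [Nn un]] := limn_sup_frequently uC e0 N.
by exists n; split => //; move: un; rewrite /limn_low; lra.
Qed.

Lemma limn_low_le_sup C u : bounded_by C u -> limn_low u <= limn_sup u.
Proof.
move=> uC; apply/ler_addgt0Pr => e e0.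
have e2 : 0 < e / 2 by rewrite divr_gt0.
have [N uN] := limn_low_eventually uC e2.
have [M uM] := limn_sup_eventually uC e2.
have := uN (maxn N M) (leq_maxl _ _); have := uM (maxn N M) (leq_maxr _ _).
lra.
Qed.

Lemma cvgn_low_supP C u : bounded_by C u -> cvgn u <-> limn_low u = limn_sup u.
Proof.
move=> uC; split.
  move=> /[dup] cu /cvg_limn_supE uE.
  have /cvg_limn_supE : cvgn (fun n => - u n) by exact: is_cvgN.
  by rewrite /limn_low uE => ->; rewrite limN// opprK.
move=> luE; apply/cvg_ex; exists (limn_sup u); apply/cvgrPdist_le => e e0.
have [N uN] := limn_low_eventually uC e0.
have [M uM] := limn_sup_eventually uC e0.
exists (maxn N M) => // n /=; rewrite geq_max => /andP[/uN + /uM].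
by rewrite luE ler_distl; lra.
Qed.

End upper_lower_limits.

Section measurable_limits.
Context d (T : measurableType d) (R : realType).
Variables (C : R) (h : nat -> T -> R).
Hypothesis mh : forall n, measurable_fun [set: T] (h n).
Hypothesis hC : forall x, bounded_by C (h ^~ x).

Lemma measurable_limn_sup : measurable_fun [set: T] (fun x => limn_sup (h ^~ x)).
Proof.
apply: measurable_fun_limn_sup => // x _; last exact: bounded_by_lbound (hC x).
exact: bounded_by_ubound (hC x).
Qed.

Lemma measurable_limn_low : measurable_fun [set: T] (fun x => limn_low (h ^~ x)).
Proof.
apply: measurable_funN.
have hC' x := bounded_byN (hC x).
apply: (measurable_fun_limn_sup (h := fun n x => - h n x)).
- by move=> x _; exact: bounded_by_ubound (hC' x).
- by move=> x _; exact: bounded_by_lbound (hC' x).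
- by move=> n; exact: measurable_funN.
Qed.

(** A bounded sequence converges exactly when its lower and upper limits agree,
and these are measurable functions of the parameter. *)
Lemma measurable_cvgn : measurable [set x | cvgn (h ^~ x)].
Proof.
rewrite (_ : [set x | _] =
  setT `&` (fun x => limn_low (h ^~ x) == limn_sup (h ^~ x)) @^-1` [set true]).
  apply: measurable_fun_eqr => //; [exact: measurable_limn_low|exact: measurable_limn_sup].
rewrite setTI; apply/seteqP; split => x /=.
  by move=> /(cvgn_low_supP (hC x)) ->; rewrite eqxx.
by move=> /eqP /(cvgn_low_supP (hC x)).
Qed.

End measurable_limits.

(** * Convergence almost everywhere for subadditive sequences *)

Section subadditive_ergodic.
Context d (T : measurableType d) (R : realType) (P : probability T R).
Variable tau : T -> T.
Hypothesis mtau : measurable_fun [set: T] tau.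
Hypothesis Ptau : forall B, measurable B -> P (tau @^-1` B) = P B.
Variables (f : nat -> T -> R) (C : R).
Hypothesis mf : forall n, measurable_fun [set: T] (f n).
Hypothesis fC : forall n x, 0 <= f n x <= C * n%:R.
Hypothesis fD : forall m n x, f (m + n)%N x <= f m x + f n (iter m tau x).
Hypothesis fS : forall n x, f n (tau x) <= f n.+1 x + C.

Let average n x := f n x / n%:R.

Let C_ge0 : 0 <= C.
Proof. by have /andP[+ +] := fC 1%N point; rewrite mulr1; exact: le_trans. Qed.

Lemma average_bounds x n : 0 <= average n x <= C.
Proof.
have /andP[f0 fn] := fC n x; rewrite /average divr_ge0//=.
case: n fn {f0} => [|n] fn; first by rewrite invr0 mulr0.
by rewrite ler_pdivrMr.
Qed.

Lemma average_bounded_by x : bounded_by C (average ^~ x).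
Proof.
by move=> n; have /andP[a0 ->] := average_bounds x n; rewrite andbT (le_trans _ a0)// oppr_le0.
Qed.

Lemma measurable_average n : measurable_fun [set: T] (average n).
Proof. by apply: measurable_funM => //; exact: measurable_cst. Qed.

Let upper x : R := limn_sup (average ^~ x).
Let lower x : R := limn_low (average ^~ x).

Let le_lower_upper x : lower x <= upper x.
Proof. exact: limn_low_le_sup (average_bounded_by x). Qed.

Let lower_ge0 x : 0 <= lower x.
Proof.
apply/ler_addgt0Pr => e e0.
have [n [_ ]] := limn_low_frequently (average_bounded_by x) e0 0.
by apply: le_trans; have /andP[] := average_bounds x n.
Qed.

Let upper_leC x : upper x <= C.
Proof.
apply/ler_addgt0Pr => e e0.
have [n [_ ]] := limn_sup_frequently (average_bounded_by x) e0 0.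
by have /andP[_] := average_bounds x n; rewrite /upper; lra.
Qed.

Let bounded_lower : bounded_measurable lower.
Proof.
split; first exact: measurable_limn_low measurable_average average_bounded_by.
by exists C => x; rewrite ger0_norm// (le_trans (le_lower_upper x)).
Qed.

Let bounded_upper : bounded_measurable upper.
Proof.
split; first exact: measurable_limn_sup measurable_average average_bounded_by.
by exists C => x; rewrite ger0_norm// (le_trans (lower_ge0 x)).
Qed.

Let average_mul n x : average n x * n%:R = f n x.
Proof.
case: n => [|n]; last by rewrite /average divfK ?pnatr_eq0.
by have := fC 0%N x; rewrite !mulr0 -eq_le => /eqP.
Qed.

(** Subadditivity only gives the opposite inequality; this one uses [fS], and it
spares an argument modulo null sets about the invariance of the lower limit. *)
Let lower_tau x : lower (tau x) <= lower x.
Proof.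
apply/ler_addgt0Pr => e e0.
have e4 : 0 < e / 4 by rewrite divr_gt0.
have [N uN] := limn_low_eventually (average_bounded_by (tau x)) e4.
have [M nM] := eventually_le_mul_nat (C + C + e) e4.
have [[|n] []] := limn_low_frequently (average_bounded_by x) e4 (maxn N M).+1; first by [].
rewrite ltnS geq_max => /andP[/uN Nn /nM Mn] un.
have := ler_wpM2r (ler0n R n) Nn; rewrite average_mul.
have := ler_wpM2r (ler0n R n.+1) un; rewrite average_mul.
rewrite -/(lower (tau x)) -/(lower x) -[n.+1%:R]natr1.
have := fS n x; have := upper_leC x; have := le_lower_upper x.
move: (lower x) (lower (tau x)) => l l'.
move=> lu uC fSn f1 f2; rewrite leNgt; apply/negP => ll'.
have := ler_wpM2r (ler0n R n) (ltW ll'); nra.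
Qed.

Let upper_tau x : upper x <= upper (tau x).
Proof.
apply/ler_addgt0Pr => e e0.
have e4 : 0 < e / 4 by rewrite divr_gt0.
have [N uN] := limn_sup_eventually (average_bounded_by (tau x)) e4.
have [M nM] := eventually_le_mul_nat (C + e) e4.
have [[|n] []] := limn_sup_frequently (average_bounded_by x) e4 (maxn N M).+1; first by [].
rewrite ltnS geq_max => /andP[/uN Nn /nM Mn] un.
have := ler_wpM2r (ler0n R n) Nn; rewrite average_mul.
have := ler_wpM2r (ler0n R n.+1) un; rewrite average_mul.
rewrite -/(upper (tau x)) -/(upper x) -[n.+1%:R]natr1.
have := fD 1 n x; have /andP[_] := fC 1 x; rewrite mulr1.
have := le_trans (lower_ge0 x) (le_lower_upper x).
rewrite /= add1n; move: (upper x) (upper (tau x)) => l l'.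
move=> l0 f1C fSn f1 f2; rewrite leNgt; apply/negP => ll'.
have := ler_wpM2r (ler0n R n) (ltW ll'); nra.
Qed.

(** The Birkhoff sum of [f m] for the map [iter m tau]. *)
Let block m j x := \sum_(i < j) f m (iter i (iter m tau) x).

Let f_le_block m r j x : f (j * m + r)%N x <= block m j x + C * r%:R.
Proof.
rewrite /block; elim: j x => [|j IHj] x.
  by rewrite big_ord0 add0r; have /andP[] := fC r x.
rewrite mulSn -addnA; apply: le_trans (fD _ _ _) _.
rewrite big_ord_recl -addrA lerD2l; apply: le_trans (IHj _) _.
by rewrite lerD2r; apply: ler_sum => i _; rewrite -iterSr.
Qed.

Let upper_tau_iter n x : upper x <= upper (iter n tau x).
Proof. by elim: n => // n IHn; exact: le_trans IHn (upper_tau _). Qed.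

Let bounded_f n : bounded_measurable (f n).
Proof.
split=> //; exists (C * n%:R) => x; have /andP[? ?] := fC n x.
by rewrite ger0_norm.
Qed.

Let integrableE := @bounded_measurable_integrable _ T R P.

Let block_bounds m j x : 0 <= block m j x <= C * m%:R * j%:R.
Proof.
apply/andP; split.
  by apply: sumr_ge0 => i _; have /andP[] := fC m (iter i (iter m tau) x).
rewrite mulr_natr -[X in _ *+ X]card_ord -sumr_const; apply: ler_sum => i _.
by have /andP[] := fC m (iter i (iter m tau) x).
Qed.

(** The covering bound yields upper bounds for integrals, while a lower bound
for that of f m is wanted here. It is therefore applied to the map [iter m tau]
and to C m j - block m j, which is additive in j and lies between 0 and C m j.
As f at time j m + r is at most block m j + C r, the quotients by j of these
functions come close to m (C - upper x), or below it, infinitely often. *)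
Let upper_integral_le m : (0 < m)%N ->
  (\int[P]_x upper x) * m%:R <= \int[P]_x (f m x).
Proof.
move=> m0; apply/ler_addgt0Pr => e e0.
have bb j : bounded_measurable (block m j).
  apply: (bounded_measurable_sum (f := fun i x => f m (iter i (iter m tau) x))) => i.
  exact/(bounded_measurable_iter (measurable_iter mtau m)).
have bc (c : R) : bounded_measurable (cst c : T -> R) by exact: bounded_measurable_cst.
have bg : bounded_measurable (fun x => m%:R * (C - upper x)).
  exact: bounded_measurableZ (bounded_measurableB (bc C) bounded_upper).
have bu j : bounded_measurable (fun x => C * m%:R * j%:R - block m j x).
  exact: bounded_measurableB (bc _) (bb j).
have [] := @subadditive_integral_le _ T R P (iter m tau) (measurable_iter mtau m)
  (invariant_iter mtau Ptau m) (fun j x => C * m%:R * j%:R - block m j x)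
  (C * m%:R) (fun x => m%:R * (C - upper x)) _ _ _ bg _ _ _ e e0.
- by move=> j; have [] := bu j.
- by move=> j x; have := block_bounds m j x; lra.
- move=> j l x; rewrite /block natrD big_split_ord /=.
  under [X in _ - (_ + X)]eq_bigr => i _ do rewrite addnC iterD.
  lra.
- by move=> x; rewrite mulr_ge0// subr_ge0.
- by move=> x; rewrite ler_wpM2l// lerB.
- move=> x e' e'0.
  pose dl := e' / (2 * m%:R).
  have d0 : 0 < dl by rewrite divr_gt0// mulr_gt0// ltr0n.
  have e2 : 0 < e' / 2 by rewrite divr_gt0.
  (* From M on, the remainder C r of a division by m is negligible. *)
  have [M nM] := eventually_le_mul_nat (C * m%:R) e2.
  have [n [Mn un]] := limn_sup_frequently (average_bounded_by x) d0 (M.+1 * m)%N.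
  have := ler_wpM2r (ler0n R n) un; rewrite average_mul -/(upper x) => {un} ufn.
  have := divn_eq n m; set j := (n %/ m)%N; set r := (n %% m)%N => nE.
  have rm : (r < m)%N by rewrite ltn_mod.
  have Mj : (M < j)%N by rewrite leq_divRL.
  exists j; split; first by apply: leq_trans Mj.
  have := f_le_block m r j x; rewrite -nE.
  have /andP[b0 _] := block_bounds m j x.
  have Crm : C * r%:R <= C * m%:R by rewrite ler_wpM2l// ler_nat ltnW.
  have := nM j (ltnW Mj) => Cmj fn.
  have dm : dl * m%:R = e' / 2.
    by rewrite /dl invfM mulrA mulfVK// pnatr_eq0 -lt0n.
  have nj : j%:R * m%:R <= n%:R :> R by rewrite -natrM ler_nat nE leq_addr.
  have [ud|ud] := leP 0 (upper x - dl).
    have := ler_wpM2l ud nj.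
    have -> : (upper x - dl) * (j%:R * m%:R) = upper x * j%:R * m%:R - dl * m%:R * j%:R by ring.
    rewrite dm; lra.
  have : (upper x - dl) * (j%:R * m%:R) <= 0.
    by rewrite mulr_le0_ge0 ?mulr_ge0// ltW.
  have -> : (upper x - dl) * (j%:R * m%:R) = upper x * j%:R * m%:R - dl * m%:R * j%:R by ring.
  rewrite dm; have := mulr_ge0 (ltW e'0) (ler0n R j); lra.
move=> j [j0].
rewrite (RintegralB measurableT (integrableE (bc _)) (integrableE (bb j))).
rewrite (RintegralZl _ measurableT (integrableE (bounded_measurableB (bc C) bounded_upper))).
rewrite (RintegralB measurableT (integrableE (bc _)) (integrableE bounded_upper)).
rewrite !Rintegral_cst_probability.
have -> : \int[P]_x block m j x = (\int[P]_x (f m x)) * j%:R.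
  rewrite (@Rintegral_sum _ _ _ P (fun i x => f m (iter i (iter m tau) x)) j); last first.
    by move=> i; exact/(bounded_measurable_iter (measurable_iter mtau m)).
  under eq_bigr => i _.
    rewrite (Rintegral_iter (measurable_iter mtau m) (invariant_iter mtau Ptau m)
      i (bounded_f m)); over.
  by rewrite sumr_const card_ord mulr_natr.
rewrite -mulrBl ler_pM2r ?ltr0n//; lra.
Qed.

(** Existence of the limit in Kingman's theorem, for a nonnegative sequence. The
two applications of the covering bound squeeze the integral of f m / m between
those of the upper and of the lower limit, up to an arbitrarily small error; as
the upper limit dominates the lower one, they agree almost everywhere. *)
Theorem subadditive_ergodic : P [set x | cvgn (fun n => f n x / n%:R)] = 1%E.
Proof.
have int_eq : \int[P]_x (upper x - lower x) = 0.
  apply/eqP; rewrite eq_le Rintegral_ge0 ?andbT; last first.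
    by move=> x _; rewrite subr_ge0.
  apply/ler_addgt0Pr => e e0; rewrite add0r.
  have [|m [m0 fm]] := subadditive_integral_le mtau Ptau mf fC fD
    bounded_lower lower_ge0 lower_tau _ e0.
    move=> x e' e'0; have [n [n0 un]] := limn_low_frequently (average_bounded_by x) e'0 1.
    by exists n; split => //; rewrite -average_mul ler_wpM2r.
  rewrite (RintegralB measurableT (integrableE bounded_upper) (integrableE bounded_lower)).
  rewrite lerBlDl -(@ler_pM2r _ m%:R) ?ltr0n//.
  exact: le_trans (upper_integral_le m0) fm.
have mD : measurable_fun [set: T] (EFin \o (fun x => upper x - lower x)).
  apply/measurable_EFinP; apply: measurable_funB.
    by case: bounded_upper.
  by case: bounded_lower.
have : ae_eq P setT (EFin \o (fun x => upper x - lower x)) (cst 0%E).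
  apply/(ae_eq_integral_abs P measurableT mD).
  rewrite (eq_integral (EFin \o (fun x => upper x - lower x))); last first.
    by move=> x _ /=; rewrite ger0_norm// subr_ge0.
  rewrite -[LHS]fineK; first by rewrite -[fine _]/(Rintegral _ _ _) int_eq.
  apply: integrable_fin_num => //.
  exact/integrableE/bounded_measurableB.
move=> [N [mN PN subN]].
have mS : measurable [set x | cvgn (average ^~ x)].
  exact: measurable_cvgn measurable_average average_bounded_by.
have := probability_setC P (measurableC mS); rewrite setCK => ->.
suff -> : P (~` [set x | cvgn (average ^~ x)]) = 0%E by rewrite sube0.
apply/eqP; rewrite eq_le measure_ge0 andbT -PN.
apply: le_measure; rewrite ?inE//; first exact: measurableC.
move=> x /= ncv; apply: subN => /= /(_ I) [ul]; apply: ncv.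
by apply/(cvgn_low_supP (average_bounded_by x)); apply/esym/eqP; rewrite -subr_eq0; apply/eqP.
Qed.

End subadditive_ergodic.

(** * The entry norm of a matrix *)

Section entry_norm.
Variable R : realType.

(** This norm replaces the operator norm in the ergodic part: it is
submultiplicative, visibly a measurable function of the entries, and comparable
to the operator norm, hence it has the same exponential growth rate. *)
Definition entry_norm m n (M : 'M[R]_(m, n)) : R := \sum_i \sum_j `|M i j|.

Lemma entry_norm_ge0 m n (M : 'M[R]_(m, n)) : 0 <= entry_norm M.
Proof. by do 2 apply: sumr_ge0 => ? _. Qed.

Lemma entry_normM m n p (M : 'M[R]_(m, n)) (N : 'M[R]_(n, p)) :
  entry_norm (M *m N) <= entry_norm M * entry_norm N.
Proof.
rewrite /entry_norm mulr_suml; apply: ler_sum => i _.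
rewrite mulr_suml.
apply: (@le_trans _ _ (\sum_j \sum_k `|M i k| * `|N k j|)).
  apply: ler_sum => j _; rewrite mxE; apply: le_trans (ler_norm_sum _ _ _) _.
  by apply: ler_sum => k _; rewrite normrM.
rewrite exchange_big /=; apply: ler_sum => k _; rewrite -mulr_sumr ler_wpM2l//.
rewrite [leRHS](bigD1 k)//= lerDl.
by do 2 apply: sumr_ge0 => ? _.
Qed.

Lemma enorm_ge0 d (v : 'cV[R]_d) : 0 <= enorm v.
Proof. exact: sqrtr_ge0. Qed.

Lemma enorm_le_entry_norm d (v : 'cV[R]_d) : enorm v <= entry_norm v.
Proof.
rewrite -(ler_pXn2r (n := 2)) ?nnegrE ?enorm_ge0 ?entry_norm_ge0//.
rewrite sqr_sqrtr; last by apply: sumr_ge0 => i _; exact: sqr_ge0.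
have -> : entry_norm v = \sum_i `|v i 0|.
  by apply: eq_bigr => i _; rewrite big_ord1.
rewrite expr2 mulr_suml; apply: ler_sum => i _; rewrite -[leLHS]ger0_norm ?sqr_ge0// normrX expr2.
rewrite ler_wpM2l// (bigD1 i)//= lerDl.
by apply: sumr_ge0.
Qed.

Lemma coord_le_enorm d (v : 'cV[R]_d) i : `|v i 0| <= enorm v.
Proof.
rewrite -(ler_pXn2r (n := 2)) ?nnegrE ?enorm_ge0// sqr_sqrtr; last first.
  by apply: sumr_ge0 => j _; exact: sqr_ge0.
rewrite real_normK ?num_real// (bigD1 i)//= lerDl.
by apply: sumr_ge0 => j _; exact: sqr_ge0.
Qed.

Lemma enorm_mul_le d (M : 'M[R]_d) v : enorm (M *m v) <= entry_norm M * enorm v.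
Proof.
apply: le_trans (enorm_le_entry_norm _) _.
rewrite /entry_norm mulr_suml; apply: ler_sum => i _; rewrite big_ord1 mxE mulr_suml.
apply: le_trans (ler_norm_sum _ _ _) _; apply: ler_sum => j _.
by rewrite normrM ler_wpM2l// coord_le_enorm.
Qed.

Lemma enorm0 d : enorm (0 : 'cV[R]_d) = 0.
Proof.
by rewrite /enorm big1 ?sqrtr0// => i _; rewrite mxE expr0n.
Qed.

Lemma enormZ d (c : R) (v : 'cV[R]_d) : enorm (c *: v) = `|c| * enorm v.
Proof.
rewrite /enorm -sqrtr_sqr -sqrtrM ?sqr_ge0//; congr Num.sqrt.
by rewrite mulr_sumr; apply: eq_bigr => i _; rewrite mxE exprMn.
Qed.

Lemma opnorm_le_entry_norm d (M : 'M[R]_d) : opnorm M <= entry_norm M.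
Proof.
apply: ge_sup; first by exists (enorm (M *m 0)); exists 0; rewrite //= enorm0.
move=> _ [v /= v1 <-]; apply: le_trans (enorm_mul_le _ _) _.
by rewrite ler_piMr// entry_norm_ge0.
Qed.

Lemma enorm_le_opnorm d (M : 'M[R]_d) v : enorm (M *m v) <= opnorm M * enorm v.
Proof.
have [v0|v0] := eqVneq (enorm v) 0.
  have := enorm_mul_le M v; rewrite v0 !mulr0; exact.
have vp : 0 < enorm v by rewrite lt_def v0 enorm_ge0.
rewrite -ler_pdivrMr// mulrC -[X in X * _]ger0_norm ?invr_ge0 ?enorm_ge0//.
rewrite -enormZ scalemxAr; apply: ub_le_sup.
  exists (entry_norm M) => _ [w /= w1 <-]; apply: le_trans (enorm_mul_le _ _) _.
  by rewrite ler_piMr// entry_norm_ge0.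
exists ((enorm v)^-1 *: v) => //=.
by rewrite enormZ ger0_norm ?invr_ge0 ?enorm_ge0// mulVf.
Qed.

Lemma entry_le_opnorm d (M : 'M[R]_d) i j : `|M i j| <= opnorm M.
Proof.
have -> : M i j = (M *m delta_mx j 0 : 'cV_d) i 0 by rewrite -colE mxE.
apply: le_trans (coord_le_enorm _ _) _; apply: le_trans (enorm_le_opnorm _ _) _.
rewrite (_ : enorm _ = 1) ?mulr1//.
rewrite /enorm (bigD1 j)//= big1 ?addr0; last first.
  by move=> k kj; rewrite mxE (negPf kj) expr0n.
by rewrite mxE !eqxx expr1n sqrtr1.
Qed.

Lemma entry_norm_le_opnorm d (M : 'M[R]_d) : entry_norm M <= (d * d)%:R * opnorm M.
Proof.
rewrite mulr_natl mulrnA.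
rewrite -[in X in _ *+ X](card_ord d) -sumr_const; apply: ler_sum => i _.
rewrite -[X in _ *+ X](card_ord d) -sumr_const; apply: ler_sum => j _.
exact: entry_le_opnorm.
Qed.

Lemma lift0_2 (i : 'I_1) : lift ord0 i = 1 :> 'I_2.
Proof. by rewrite ord1; apply/val_inj. Qed.

Lemma lift1_2 (i : 'I_1) : lift 1 i = 0 :> 'I_2.
Proof. by rewrite ord1; apply/val_inj. Qed.

Lemma sum2E (V : nmodType) (F : 'I_2 -> V) : \sum_i F i = F 0 + F 1.
Proof. by rewrite !big_ord_recl big_ord0 addr0 lift0_2. Qed.

Lemma det2E (M : 'M[R]_2) : \det M = M 0 0 * M 1 1 - M 0 1 * M 1 0.
Proof.
rewrite (expand_det_row _ 0) sum2E /cofactor !det_mx11 !mxE !lift0_2 !lift1_2.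
by rewrite expr0 expr1 mul1r mulN1r mulrN.
Qed.

Lemma entry_norm2E (M : 'M[R]_2) :
  entry_norm M = `|M 0 0| + `|M 0 1| + (`|M 1 0| + `|M 1 1|).
Proof. by rewrite /entry_norm !sum2E. Qed.

(** A matrix of determinant 1 cannot have a small norm, so that the logarithm of
the norm is bounded below along the cocycle. *)
Lemma entry_norm_det2 (M : 'M[R]_2) : `|\det M| <= entry_norm M ^+ 2.
Proof.
rewrite det2E entry_norm2E.
apply: le_trans (ler_normB _ _) _; rewrite !normrM.
have := normr_ge0 (M 0 0); have := normr_ge0 (M 0 1).
have := normr_ge0 (M 1 0); have := normr_ge0 (M 1 1).
move: `|M 0 0| `|M 0 1| `|M 1 0| `|M 1 1| => a b c e; nra.
Qed.

(** For determinant 1 the adjugate is the inverse, and a matrix and its inverse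
have the same norm. *)
Lemma entry_norm_adj2 (M : 'M[R]_2) : entry_norm (\adj M) = entry_norm M.
Proof.
rewrite !entry_norm2E !mxE /cofactor !normrM !normrX !normrN1 !expr1n !mul1r.
rewrite !det_mx11 !mxE.
rewrite !lift0_2 !lift1_2.
by lra.
Qed.

End entry_norm.

(** * Lyapunov exponents of bounded measurable cocycles *)

Lemma cvgn_close (R : realType) (c : R) (u v : R^nat) :
  (forall n, `|u n - v n| <= c / n%:R) -> cvgn v -> cvgn u.
Proof.
move=> uv /cvg_ex[l vl]; apply/cvg_ex; exists l; apply/cvgrPdist_le => e e0.
have e2 : 0 < e / 2 by rewrite divr_gt0.
have /cvgrPdist_le /(_ _ e2) [N _ Nv] := vl.
have [M cM] := eventually_le_mul_nat c e2.
exists (maxn N M) => // n /=; rewrite geq_max => /andP[/Nv /= vn /cM cn].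
have : c / n%:R <= e / 2.
  have [->|n0] := eqVneq n 0%N; first by rewrite invr0 mulr0 ltW.
  by rewrite ler_pdivrMr// ltr0n lt0n.
have := uv n; have -> : l - u n = (l - v n) - (u n - v n) by ring.
have := ler_normB (l - v n) (u n - v n); lra.
Qed.

Section cocycle_algebra.
Variables (X : Type) (R : realType) (d : nat) (tau : X -> X) (A : X -> 'M[R]_d).

Lemma cocycle_powD m n x :
  cocycle_pow tau A (m + n) x = cocycle_pow tau A n (iter m tau x) *m cocycle_pow tau A m x.
Proof.
elim: n => [|n IHn]; first by rewrite addn0 mul1mx.
by rewrite addnS /= IHn mulmxA -iterD addnC.
Qed.

Lemma cocycle_pow1 x : cocycle_pow tau A 1 x = A x.
Proof. by rewrite /= mulmx1. Qed.

Lemma det_cocycle_pow n x : (forall y, \det (A y) = 1) -> \det (cocycle_pow tau A n x) = 1.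
Proof.
by move=> detA; elim: n => [|n IHn] /=; rewrite ?det1// det_mulmx IHn detA mulr1.
Qed.

End cocycle_algebra.

Section lyapunov_limit.
Context d (T : measurableType d) (R : realType).
Variables (tau : T -> T) (A : T -> 'M[R]_2) (K : R).
Hypothesis mtau : measurable_fun [set: T] tau.
Hypothesis mA : forall i j, measurable_fun [set: T] (fun x => A x i j).
Hypothesis detA : forall x, \det (A x) = 1.
Hypothesis AK : forall x, entry_norm (A x) <= K.

Local Notation pow := (cocycle_pow tau A).

Lemma entry_norm_ge1 (M : 'M[R]_2) : \det M = 1 -> 1 <= entry_norm M.
Proof.
move=> M1; have := entry_norm_det2 M; rewrite M1 normr1.
by rewrite -[leLHS](expr1n _ 2) ler_pXn2r ?nnegrE// entry_norm_ge0.
Qed.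

Lemma entry_norm_pow_gt0 n x : 0 < entry_norm (pow n x).
Proof. by rewrite (lt_le_trans ltr01)// entry_norm_ge1// det_cocycle_pow. Qed.

(** Time 0 is set apart because the entry norm of the identity matrix is 2,
whereas the bound of time n by a multiple of n requires the value 0 there. *)
Definition log_norm n x : R := if n is 0%N then 0 else ln (entry_norm (pow n x)).

Lemma log_norm_ge0 n x : 0 <= log_norm n x.
Proof. by case: n => // n; apply: ln_ge0; rewrite entry_norm_ge1// det_cocycle_pow. Qed.

Lemma log_normD m n x : log_norm (m + n)%N x <= log_norm m x + log_norm n (iter m tau x).
Proof.
case: m => [|m]; first by rewrite add0n add0r.
case: n => [|n]; first by rewrite addn0 addr0.
rewrite addSn /log_norm -addSn -lnM ?posrE ?entry_norm_pow_gt0//.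
rewrite ler_ln ?posrE ?mulr_gt0 ?entry_norm_pow_gt0//.
by rewrite cocycle_powD mulrC entry_normM.
Qed.

Lemma log_norm1_le x : log_norm 1 x <= ln K.
Proof.
have p0 := entry_norm_pow_gt0 1 x.
rewrite /log_norm ler_ln ?posrE// ?cocycle_pow1//.
by rewrite (lt_le_trans _ (AK x))// -(cocycle_pow1 tau A x).
Qed.

Lemma log_norm_le n x : log_norm n x <= ln K * n%:R.
Proof.
elim: n x => [|n IHn] x; first by rewrite mulr0.
rewrite -addn1; apply: le_trans (log_normD _ _ _) _.
by rewrite natrD mulrDr mulr1 lerD// log_norm1_le.
Qed.

(** This holds because A^n (tau x) = A^(n+1) x * (A x)^-1. *)
Lemma log_normS n x : log_norm n (tau x) <= log_norm n.+1 x + ln K.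
Proof.
have lK0 : 0 <= ln K by have := log_norm1_le x; apply: le_trans; exact: log_norm_ge0.
case: n => [|n]; first by rewrite addr_ge0// log_norm_ge0.
have K0 : 0 < K by rewrite (lt_le_trans _ (AK x))// -(cocycle_pow1 tau A x) entry_norm_pow_gt0.
rewrite /log_norm -lnM ?posrE ?entry_norm_pow_gt0//.
rewrite ler_ln ?posrE ?mulr_gt0 ?entry_norm_pow_gt0//.
have -> : pow n.+1 (tau x) = pow n.+2 x *m \adj (A x).
  rewrite -[n.+2]add1n cocycle_powD cocycle_pow1 -mulmxA mul_mx_adj detA.
  by rewrite mulmx1.
apply: le_trans (entry_normM _ _) _.
by rewrite entry_norm_adj2 ler_wpM2l// entry_norm_ge0.
Qed.

Lemma measurable_cocycle_pow n i j : measurable_fun [set: T] (fun x => pow n x i j).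
Proof.
elim: n i j => [|n IHn] i j; first exact: measurable_cst.
rewrite (_ : (fun x => _) = fun x => \sum_k A (iter n tau x) i k * pow n x k j).
  apply: measurable_sum => k; apply: measurable_funM => //.
  exact: (measurableT_comp (mA i k) (measurable_iter mtau n)).
by apply/funext => x; rewrite /= mxE.
Qed.

Lemma measurable_log_norm n : measurable_fun [set: T] (log_norm n).
Proof.
case: n => [|n]; first exact: measurable_cst.
apply: (measurableT_comp (@measurable_ln R)).
rewrite /entry_norm; do 2 apply: measurable_sum => ?.
by apply: measurableT_comp => //; exact: measurable_cocycle_pow.
Qed.

Lemma lyapunov_seq_log_norm x n :
  `|lyapunov_seq tau A x n - log_norm n x / n%:R| <= ln 4 / n%:R.
Proof.
case: n => [|n]; first by rewrite /lyapunov_seq invr0 !mulr0 subrr normr0.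
rewrite /lyapunov_seq -mulrBl normrM [X in _ * X]ger0_norm ?invr_ge0// ler_wpM2r ?invr_ge0//.
have N0 := entry_norm_pow_gt0 n.+1 x.
have le1 := opnorm_le_entry_norm (pow n.+1 x).
have le4 := entry_norm_le_opnorm (pow n.+1 x).
have o0 : 0 < opnorm (pow n.+1 x) by move: (lt_le_trans N0 le4); rewrite pmulr_rgt0.
rewrite distrC ger0_norm ?subr_ge0 ?ler_ln ?posrE//.
by rewrite lerBlDr -lnM ?posrE// ler_ln ?posrE// mulr_gt0.
Qed.

Lemma lyapunov_cvgE :
  [set x | cvgn (lyapunov_seq tau A x)] = [set x | cvgn (fun n => log_norm n x / n%:R)].
Proof.
have close x n := lyapunov_seq_log_norm x n.
apply/seteqP; split => x /=; last exact: cvgn_close (close x).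
by apply: (cvgn_close (c := ln 4)) => n; rewrite distrC; exact: close.
Qed.

Lemma measurable_lyapunov_cvg : measurable [set x | cvgn (lyapunov_seq tau A x)].
Proof.
rewrite lyapunov_cvgE.
have b n x : 0 <= log_norm n x <= ln K * n%:R by rewrite log_norm_ge0 log_norm_le.
apply: measurable_cvgn (measurable_average measurable_log_norm) (average_bounded_by b).
Qed.

Lemma lyapunov_cvg_ae (P : probability T R) :
  (forall B, measurable B -> P (tau @^-1` B) = P B) ->
  P [set x | cvgn (lyapunov_seq tau A x)] = 1%E.
Proof.
move=> Ptau; rewrite lyapunov_cvgE.
apply: (subadditive_ergodic mtau Ptau (C := ln K)).
- exact: measurable_log_norm.
- by move=> n x; rewrite log_norm_ge0 log_norm_le.
- exact: log_normD.
- exact: log_normS.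
Qed.

End lyapunov_limit.

(** * Topology and Borel sets of the full shift *)

Section borel.
Context (R : realType) (X : ptopologicalType).

Lemma continuous_measurable_borel (f : X -> R) : continuous f ->
  measurable_fun [set: borel_of X] (f : borel_of X -> R).
Proof.
move=> cf; apply: (measurability _ (RGenOInfty.measurableE R)) => //.
move=> _ [_ [x ->] <-]; rewrite setTI; apply: sub_sigma_algebra.
by apply: (open_comp (fun y _ => cf y)); exact: rray_open.
Qed.

Lemma continuous_measurable_borel_self (T : X -> X) : continuous T ->
  measurable_fun [set: borel_of X] (T : borel_of X -> borel_of X).
Proof.
move=> cT; apply: (measurability _ (erefl : @measurable _ (borel_of X) = <<s @open X >>)) => //.
move=> _ [A oA <-]; rewrite setTI; apply: sub_sigma_algebra.
by apply: (open_comp (fun y _ => cT y)).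
Qed.

End borel.

Section topology.
Variable R : realType.
Local Notation X := (fullshift R).
Implicit Types x y : X.

Definition agree (N : nat) x y := forall n : int, (`|n| <= N)%N -> y n = x n.

Lemma shift_nbhsP x (S : set X) : nbhs x S <-> exists N, forall y, agree N x y -> S y.
Proof.
split.
  move=> /nbhs_ballP[e /= e0 eS].
  have [N Ne] := eventually_le_mul_nat 1 e0.
  exists N => y xy; apply: eS; rewrite ballEmdist /=.
  rewrite /mdist /= /shift_dist; case: asboolP => // /diffset0 /natminP[[n [xyn <-]] _].
  have Nn : (N < `|n|)%N by rewrite ltnNge; apply: contraNN xyn => /xy ->.
  rewrite -[_^-1]mul1r ltr_pdivrMr ?exprn_gt0//.
  apply: le_lt_trans (Ne N _) _ => //; rewrite ltr_pM2l//.
  by rewrite -natrX ltr_nat (ltn_trans Nn)// ltn_expl.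
move=> [N NS]; apply/nbhs_ballP; exists (2 ^- N) => /=; first by rewrite invr_gt0 exprn_gt0.
move=> y; rewrite ballEmdist /= /mdist /= => xy; apply: NS => n nN.
apply/eqP; rewrite eq_sym; apply/negPn/negP => /shift_dist_ge; rewrite leNgt => /negP; apply.
apply: lt_le_trans xy _; rewrite lef_pV2 ?posrE ?exprn_gt0//.
by rewrite ler_eXn2l ?ltr1n.
Qed.

Lemma shift_map_continuous : continuous (@shift_map R).
Proof.
move=> x S /shift_nbhsP[N NS]; apply/shift_nbhsP; exists N.+1 => y xy.
by apply: NS => n nN; apply: xy; lia.
Qed.

Lemma shift_map_inv_continuous : continuous (@shift_map_inv R).
Proof.
move=> x S /shift_nbhsP[N NS]; apply/shift_nbhsP; exists N.+1 => y xy.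
by apply: NS => n nN; apply: xy; lia.
Qed.

Lemma shift_homeomorphism : homeomorphism (@shift_map R) (@shift_map_inv R).
Proof.
split; [exact: shift_map_continuous|exact: shift_map_inv_continuous| |];
  by move=> x; apply/funext => n; rewrite /shift_map /shift_map_inv ?addrK ?subrK.
Qed.

(** The metric topology is no finer than the product topology, which is compact
by Tychonoff's theorem. *)
Lemma fullshift_compact : compact [set: X].
Proof.
pose PT := prod_topology (fun _ : int => bool).
have cPT : compact [set: PT].
  have := @tychonoff int (fun=> bool) (fun=> setT) (fun=> bool_compact).
  by congr compact; apply/seteqP; split.
pose F : PT -> X := fun f => f.
have -> : [set: X] = F @` [set: PT] by apply/seteqP; split => x // _; exists x.
apply: (@continuous_compact PT X F setT _ cPT).
apply: continuous_subspaceT => x S /shift_nbhsP[N NS].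
have nb (n : int) : nbhs (x : PT) [set y : PT | y n = x n].
  apply: (@proj_continuous int (fun=> bool) n x [set b | b = x n]).
  exact: discrete_set1.
pose same (m : 'I_N.+1) := [set y : PT | y m%:Z = x m%:Z /\ y (- m%:Z) = x (- m%:Z)].
have nbN : nbhs (x : PT) [set y : PT | forall m, same m y].
  apply: (@filter_forall PT 'I_N.+1 same (nbhs (x : PT)) _ _) => m.
  by apply: filterI; exact: nb.
apply: filterS nbN => y yx; apply: NS => n nN.
have [] := yx (Ordinal (nN : (`|n| < N.+1)%N)).
by case: n nN => m mN.
Qed.

End topology.

(** * Continuity of the cocycle *)

Section cocycle.
Variable R : realType.
Local Notation X := (fullshift R).
Local Notation q := (q R).
Implicit Types x y : X.

Lemma k_min x (n : int) : n != 0 -> x n -> (k x <= `|n|)%N.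
Proof.
move=> n0 xn; have [] := @natminP [set m | exists n : int, [/\ n != 0, x n & `|n|%N = m]].
  by exists `|n|%N, n.
by move=> _; apply; exists n.
Qed.

Lemma k_attained x : (exists n : int, n != 0 /\ x n) ->
  exists n : int, [/\ n != 0, x n & `|n|%N = k x].
Proof.
move=> [n [n0 xn]].
have [] := @natminP [set m | exists n : int, [/\ n != 0, x n & `|n|%N = m]] => //.
by exists `|n|%N, n.
Qed.

Lemma neq_q x : x 0 -> x <> q -> exists n : int, n != 0 /\ x n.
Proof.
move=> x0 xq; apply: contrapT => /forallNP h; apply: xq; apply/funext => n.
rewrite /Defs.q; have [->//|n0] := eqVneq n 0.
by apply/negbTE/negP => xn; apply: (h n).
Qed.

Lemma theta_q k0 : theta k0 q = pi / 2.
Proof. by rewrite /theta asboolT. Qed.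

Lemma theta_rot k0 x : x <> q -> x 0 -> (k0 < k x)%N ->
  theta k0 x = pi / 2 - 2 `^ (- (k x)%:R / 8).
Proof. by move=> xq x0 kx; rewrite /theta asboolF// asboolT. Qed.

Lemma theta_0 k0 x : x <> q -> ~ (x 0 /\ (k0 < k x)%N) -> theta k0 x = 0.
Proof. by move=> xq h; rewrite /theta asboolF// asboolF. Qed.

Lemma theta_notV k0 x : ~~ x 0 -> theta k0 x = 0.
Proof.
move=> x0; apply: theta_0; last by move=> [xV]; rewrite xV in x0.
by move=> xq; rewrite xq in x0.
Qed.

Lemma powR_lt_eps (e : R) : 0 < e -> exists N, forall n, (N <= n)%N ->
  2 `^ (- n%:R / 8) <= e.
Proof.
move=> e0; have l0 : 0 < ln 2 * e / 8 :> R.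
  by rewrite divr_gt0// mulr_gt0// ln_gt0// ltr1n.
have [N Ne] := eventually_le_mul_nat 1 l0.
exists N => n /Ne en; rewrite mulNr powRN invf_ple ?posrE ?powR_gt0//.
rewrite /powR pnatr_eq0 /=; apply: le_trans (expR_ge1Dx _).
rewrite -[e^-1]mul1r ler_pdivrMr//; lra.
Qed.

(** Near a point of V other than [q], the angle is determined by finitely many
coordinates, up to the nearest other one. Near [q] the nearest other one is far
away, so the angle is within 2^(-k/8) of the quarter turn. *)
Lemma theta_continuous k0 : continuous (@theta R k0).
Proof.
move=> x; apply/(@cvgrPdist_le _ _ _ (nbhs x) (@nbhs_filter X x)) => e e0; apply/shift_nbhsP.
have [->|xq] := pselect (x = q).
  have [N Ne] := powR_lt_eps e0.
  exists (maxn k0 N).+1 => y qy; rewrite theta_q.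
  have [->|yq] := pselect (y = q); first by rewrite theta_q subrr normr0 ltW.
  have y0 : y 0 by rewrite qy.
  have [n [n0 yn nk]] := k_attained (neq_q y0 yq).
  have ky : (maxn k0 N < k y)%N.
    rewrite ltnNge -nk; apply/negP => nN.
    by move: yn; rewrite qy ?(leqW nN)// /Defs.q (negbTE n0).
  rewrite theta_rot//; last by rewrite (leq_ltn_trans (leq_maxl _ N)).
  rewrite opprD addrA subrr add0r opprK ger0_norm ?powR_ge0//.
  by apply: Ne; rewrite ltnW// (leq_ltn_trans (leq_maxr k0 _)).
have [x0|x0] := boolP (x 0); last first.
  exists 0%N => y xy; rewrite !theta_notV ?subrr ?normr0 ?(ltW e0)//.
  by rewrite xy.
have [n [n0 xn nk]] := k_attained (neq_q x0 xq).
exists (k x) => y xy.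
have yn : y n by rewrite xy ?nk.
have y0 : y 0 by rewrite xy.
have yq : y <> q by move=> yq; rewrite yq /Defs.q (negbTE n0) in yn.
have kyx : k y = k x.
  have [p [p0 yp kp]] := k_attained (neq_q y0 yq).
  apply/eqP; rewrite eqn_leq -{1}nk k_min//= -kp k_min//.
  by rewrite -xy// kp -nk k_min.
suff -> : theta k0 y = theta k0 x by rewrite subrr normr0 ltW.
have [kx|kx] := boolP (k0 < k x)%N; first by rewrite !theta_rot ?kyx.
by rewrite !theta_0 ?kyx//; move=> []; rewrite (negbTE kx).
Qed.

Lemma shift_cocycle00 k0 x : shift_cocycle k0 x 0 0 = 2 * cos (theta k0 x).
Proof. by rewrite mxE sum2E !mxE /= mul0r addr0. Qed.

Lemma shift_cocycle01 k0 x : shift_cocycle k0 x 0 1 = - (2 * sin (theta k0 x)).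
Proof. by rewrite mxE sum2E !mxE /= mul0r addr0 mulrN. Qed.

Lemma shift_cocycle10 k0 x : shift_cocycle k0 x 1 0 = 2^-1 * sin (theta k0 x).
Proof. by rewrite mxE sum2E !mxE /= mul0r add0r. Qed.

Lemma shift_cocycle11 k0 x : shift_cocycle k0 x 1 1 = 2^-1 * cos (theta k0 x).
Proof. by rewrite mxE sum2E !mxE /= mul0r add0r. Qed.

Definition shift_cocycleE := (shift_cocycle00, shift_cocycle01, shift_cocycle10, shift_cocycle11).

Lemma det_shift_cocycle k0 x : \det (shift_cocycle k0 x) = 1.
Proof.
rewrite det2E !shift_cocycleE; have := cos2Dsin2 (theta k0 x).
by move=> h; rewrite -[RHS]h; field.
Qed.

Lemma ord2_cases (P : 'I_2 -> Prop) : P 0 -> P 1 -> forall i, P i.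
Proof.
move=> P0 P1 [[|[|//]] i2].
- by rewrite (_ : Ordinal i2 = 0)//; apply/val_inj.
- by rewrite (_ : Ordinal i2 = 1)//; apply/val_inj.
Qed.

Lemma entry_continuous k0 i j : continuous (fun x => @shift_cocycle R k0 x i j).
Proof.
have cc : continuous (fun x => cos (@theta R k0 x)).
  move=> x; apply: continuous_comp; [exact: theta_continuous|exact: continuous_cos].
have cs : continuous (fun x => sin (@theta R k0 x)).
  move=> x; apply: continuous_comp; [exact: theta_continuous|exact: continuous_sin].
have cM (c : R) (f : X -> R) : continuous f -> continuous (fun x => c * f x).
  by move=> cf x; apply: continuousM; [exact: cst_continuous|exact: cf].
elim/ord2_cases: i; elim/ord2_cases: j.
- rewrite (_ : (fun x => _) = fun x => 2 * cos (theta k0 x)); first exact: cM.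
  by apply/funext => x; rewrite shift_cocycleE.
- rewrite (_ : (fun x => _) = fun x => - 2 * sin (theta k0 x)); first exact: cM.
  by apply/funext => x; rewrite shift_cocycleE mulNr.
- rewrite (_ : (fun x => _) = fun x => 2^-1 * sin (theta k0 x)); first exact: cM.
  by apply/funext => x; rewrite shift_cocycleE.
- rewrite (_ : (fun x => _) = fun x => 2^-1 * cos (theta k0 x)); first exact: cM.
  by apply/funext => x; rewrite shift_cocycleE.
Qed.

Lemma shift_cocycle_continuous k0 : continuous (@shift_cocycle R k0).
Proof.
move=> x S [Q MQ QS].
have h i j : nbhs x [set y | Q i j (shift_cocycle k0 y i j)].
  exact: (entry_continuous (MQ i j)).
have hi i : nbhs x [set y | forall j, Q i j (shift_cocycle k0 y i j)].
  exact: (@filter_forall X _ (fun j => [set y | Q i j (shift_cocycle k0 y i j)])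
    (nbhs x) (nbhs_filter x) (h i)).

apply: (@filterS X (nbhs x) (nbhs_filter x) _ _ _ (@filter_forall X 'I_2
  (fun i => [set y | forall j, Q i j (shift_cocycle k0 y i j)])
  (nbhs x) (nbhs_filter x) hi)).
by move=> y Qy; apply: QS.
Qed.

Lemma shift_SL2_cocycle k0 :
  SL2_cocycle (@shift_map R) (@shift_map_inv R) (@shift_cocycle R k0).
Proof.
split; last exact: det_shift_cocycle.
split; [exact: fullshift_compact|exact: shift_homeomorphism|exact: shift_cocycle_continuous|].
by move=> x; rewrite unitmxE det_shift_cocycle unitr1.
Qed.

Lemma entry_norm_shift_cocycle k0 x : entry_norm (shift_cocycle k0 x) <= 5.
Proof.
rewrite entry_norm2E !shift_cocycleE.
have := cos_max (theta k0 x); have := sin_max (theta k0 x).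
rewrite normrN !normrM normfV (ger0_norm (ler0n R 2)); lra.
Qed.

End cocycle.

(** * Failure of uniform hyperbolicity *)

Section dynamics.
Variable R : realType.
Local Notation X := (fullshift R).
Local Notation q := (q R).
Local Notation T := (@shift_map R).
Local Notation T' := (@shift_map_inv R).
Implicit Types (x : X) (v : 'cV[R]_2).

Lemma iter_shift n x (m : int) : iter n T x m = x (m + n%:Z).
Proof.
elim: n m => [|n IHn] m; first by rewrite addr0.
by rewrite /= /shift_map IHn -addrA intS.
Qed.

Lemma iter_shift_inv n x (m : int) : iter n T' x m = x (m - n%:Z).
Proof.
elim: n m => [|n IHn] m; first by rewrite subr0.
by rewrite /= /shift_map_inv IHn -addrA -opprD intS.
Qed.

Section fixed_threshold.
Variable k0 : nat.
Local Notation A := (@shift_cocycle R k0).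
Local Notation pow := (cocycle_pow T A).

Lemma mul_cocycle0 x v : (A x *m v) 0 0 =
  2 * (cos (theta k0 x) * v 0 0 - sin (theta k0 x) * v 1 0).
Proof. by rewrite mxE sum2E !shift_cocycleE; ring. Qed.

Lemma mul_cocycle1 x v : (A x *m v) 1 0 =
  2^-1 * (sin (theta k0 x) * v 0 0 + cos (theta k0 x) * v 1 0).
Proof. by rewrite mxE sum2E !shift_cocycleE; ring. Qed.

Lemma mul_cocycle_notV0 x v : ~~ x 0 -> (A x *m v) 0 0 = 2 * v 0 0.
Proof. by move=> x0; rewrite mul_cocycle0 theta_notV// cos0 sin0; ring. Qed.

Lemma mul_cocycle_notV1 x v : ~~ x 0 -> (A x *m v) 1 0 = 2^-1 * v 1 0.
Proof. by move=> x0; rewrite mul_cocycle1 theta_notV// cos0 sin0; ring. Qed.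

Lemma mul_pow_notV n x v : (forall m, (m < n)%N -> ~~ x m%:Z) ->
  (pow n x *m v) 0 0 = 2 ^+ n * v 0 0 /\ (pow n x *m v) 1 0 = 2 ^- n * v 1 0.
Proof.
elim: n => [|n IHn] xn; first by rewrite mul1mx !expr0 invr1 !mul1r.
have [|w0 w1] := IHn; first by move=> m mn; apply: xn; exact: ltnW.
have xn0 : ~~ iter n T x 0 by rewrite iter_shift add0r xn.
rewrite /= -mulmxA mul_cocycle_notV0// mul_cocycle_notV1// w0 w1.
by rewrite !exprS invfM !mulrA.
Qed.

Lemma mul_negpow_notV n x v : (forall m, ~~ x (- m.+1%:Z)) ->
  (cocycle_negpow T' A n x *m v) 1 0 = 2 ^+ n * v 1 0.
Proof.
move=> xn; elim: n => [|n IHn]; first by rewrite mul1mx expr0 mul1r.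
rewrite [cocycle_negpow _ _ _ _]/= -mulmxA.
set y := T' (iter n T' x); set u := cocycle_negpow _ _ _ _ *m v.
have y0 : ~~ y 0 by rewrite /y -[T' _]/(iter n.+1 T' x) iter_shift_inv add0r xn.
have Ay : A y \in unitmx by rewrite unitmxE det_shift_cocycle unitr1.
have : (A y *m (invmx (A y) *m u)) 1 0 = u 1 0 by rewrite mulmxA mulmxV// mul1mx.
rewrite mul_cocycle_notV1// {2}/u IHn exprS -mulrA => <-.
by rewrite mulrA divff ?mul1r// pnatr_eq0.
Qed.

Lemma bounded_geometric_eq0 (a c : R) : (forall n, (0 < n)%N -> `|2 ^+ n * a| <= c) -> a = 0.
Proof.
move=> ac; apply/eqP; apply/negPn/negP => a0.
have na : 0 < `|a| by rewrite normr_gt0.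
have [N Nc] := eventually_le_mul_nat (c + 1) na.
have := ac N.+1 isT; rewrite normrM ger0_norm ?exprn_ge0//.
have := Nc N.+1 (leqnSn N).
have : `|a| * N.+1%:R <= 2 ^+ N.+1 * `|a|.
  by rewrite mulrC ler_wpM2r// -natrX ler_nat ltnW// ltn_expl.
lra.
Qed.

(** The orbit of [q] sees the diagonal matrix at all times but one. Contraction
in the future of T q and in the past of [q] determines the lines Es (T q), which
is vertical, and Eu q, which is horizontal; the quarter turn at [q] maps the
latter onto the former. *)
Lemma not_uniformly_hyperbolic : ~ uniformly_hyperbolic T T' A.
Proof.
move=> [c [lam [c0 lam0 lam1 [Es [Eu [dimE invE contr]]]]]].
have qn (n : int) : n != 0 -> ~~ q n by [].
have Tqn (m : nat) : ~~ T q m%:Z by apply: qn; lia.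
have qN (m : nat) : ~~ q (- m.+1%:Z) by apply: qn; lia.
have decay n (w : 'cV[R]_2) : c * lam ^+ n * enorm w <= c * enorm w.
  by rewrite ler_wpM2r ?enorm_ge0// ler_piMr ?(ltW c0)// exprn_ile1// ltW.
have Es0 v : v \in Es (T q) -> v 0 0 = 0.
  move=> vE; apply: (@bounded_geometric_eq0 _ (c * enorm v)) => n n0.
  have [+ _] := contr (T q) v 0 n vE (mem0v _) n0.
  have [<- _] := @mul_pow_notV n (T q) v (fun m _ => Tqn m).
  move=> h; exact: le_trans (coord_le_enorm _ _) (le_trans h (decay _ _)).
have Eu1 v : v \in Eu q -> v 1 0 = 0.
  move=> vE; apply: (@bounded_geometric_eq0 _ (c * enorm v)) => n n0.
  have [_ +] := contr q 0 v n (mem0v _) vE n0.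
  rewrite -(@mul_negpow_notV n q v qN).
  move=> h; exact: le_trans (coord_le_enorm _ _) (le_trans h (decay _ _)).
have vpick1 (E : {vspace 'cV[R]_2}) : \dim E = 1%N -> exists v, v \in E /\ v != 0.
  move=> dE; exists (vpick E); split; first exact: memv_pick.
  by rewrite vpick0 -dimv_eq0 dE.
have [_ dEu _] := dimE q.
have [dEs _ tr] := dimE (T q).
have [u [uE un0]] := vpick1 _ dEu.
have [v [vE vn0]] := vpick1 _ dEs.
have cV_eq (w z : 'cV[R]_2) : w 0 0 = z 0 0 -> w 1 0 = z 1 0 -> w = z.
  by move=> h0 h1; apply/matrixP => i j; rewrite ord1; move: i; apply: ord2_cases.
have Au0 : (A q *m u) 0 0 = 0.
  by rewrite mul_cocycle0 theta_q cos_pihalf (Eu1 u uE); ring.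
have Au1 : (A q *m u) 1 0 = 2^-1 * u 0 0.
  by rewrite mul_cocycle1 theta_q cos_pihalf sin_pihalf; ring.
have v1 : v 1 0 != 0.
  by apply: contraNneq vn0 => v1; apply/eqP/cV_eq; rewrite mxE// Es0.
have AuEs : A q *m u \in Es (T q).
  have -> : A q *m u = (2^-1 * u 0 0 / v 1 0) *: v.
    apply: cV_eq; rewrite [RHS]mxE; first by rewrite Au0 (Es0 v vE) mulr0.
    by rewrite Au1 divfK.
  exact: memvZ.
have AuEu : A q *m u \in Eu (T q).
  have [_ <-] := invE q.
  have -> : A q *m u = linfun (mulmx (A q)) u by rewrite lfunE.
  exact: memv_img.
have /eqP : A q *m u == 0 by rewrite -memv0 -tr memv_cap AuEs.
move=> Au; move: Au1; rewrite Au mxE => /esym/eqP.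
rewrite mulf_eq0 invr_eq0 pnatr_eq0 /= => /eqP u0.
by move/eqP: un0; apply; apply: cV_eq; rewrite mxE// Eu1.
Qed.

End fixed_threshold.
End dynamics.

(** * Growth along an orbit *)

Section growth.
Variable R : realType.
Local Notation X := (fullshift R).
Local Notation q := (q R).
Local Notation T := (@shift_map R).
Implicit Types (x : X) (v : 'cV[R]_2).
Local Notation A := (@shift_cocycle R 8).
Local Notation pow := (cocycle_pow T A).

Lemma sin_ge_half (e : R) : 0 < e -> e <= 2^-1 -> e / 2 <= sin e.
Proof.
move=> e0 e1.
have [c] := @MVT _ sin cos 0 e e0 (fun t _ => is_derive_sin t)
  (continuous_subspaceT (@continuous_sin R)).
rewrite in_itv /= => /andP[c0 ce]; rewrite sin0 !subr0 => ->.
have [b _] := @MVT _ cos (fun t => - sin t) 0 c c0 (fun t _ => is_derive_cos t)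
  (continuous_subspaceT (@continuous_cos R)).
rewrite cos0 subr0 => cosc.
have bc : sin b * c <= 1 * c by rewrite ler_pM2r// sin_le1.
have cc : 2^-1 <= cos c by lra.
by rewrite mulrC; apply: ler_wpM2r => //; exact: ltW.
Qed.

Lemma powR2D (a b : R) : 2 `^ (a + b) = 2 `^ a * 2 `^ b :> R.
Proof. by rewrite powRD// pnatr_eq0 implybT. Qed.

Lemma powR2_nat n : 2 `^ n%:R = 2 ^+ n :> R.
Proof. by rewrite powR_mulrn. Qed.

Lemma ler_powR2 (a b : R) : a <= b -> 2 `^ a <= 2 `^ b :> R.
Proof. by move=> ab; rewrite ler_powR// ler1n. Qed.

(** Between two consecutive ones at distance g, the cocycle acts by the rotation
attached to the first of them, followed by g steps of the diagonal matrix. *)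
Lemma mul_return x v g : (0 < g)%N -> (forall m, (0 < m < g)%N -> ~~ x m%:Z) ->
  (pow g x *m v) 0 0 = 2 ^+ g * (cos (theta 8 x) * v 0 0 - sin (theta 8 x) * v 1 0) /\
  (pow g x *m v) 1 0 = 2 ^- g * (sin (theta 8 x) * v 0 0 + cos (theta 8 x) * v 1 0).
Proof.
case: g => // g _ xg; rewrite -[g.+1]add1n cocycle_powD cocycle_pow1 -mulmxA.
have [|-> ->] := @mul_pow_notV R 8 g (iter 1 T x) (A x *m v).
  by move=> m mg; rewrite iter_shift addrC -intS; apply: xg.
by rewrite mul_cocycle0 mul_cocycle1 add1n !exprSr invfM !mulrA.
Qed.

(** The cone |v1| <= 2^-k v0 is carried into the cone |v1| <= 2^-g v0 while the
horizontal coordinate grows by 2^(g/2). In the delicate case 8 < k x the angle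
misses the quarter turn by e = 2^(-k/8): the incoming vertical part is at most
e/4 of the horizontal one, the rotation leaves at least a fraction
e/2 - e/4 of the latter, and g free steps more than make up for the loss. *)
Lemma cone_return x v g : x 0 -> (0 < g)%N -> x g%:Z ->
  (forall m, (0 < m < g)%N -> ~~ x m%:Z) ->
  0 < v 0 0 -> `|v 1 0| <= 2 ^- k x * v 0 0 ->
  2 `^ (g%:R / 2) * v 0 0 <= (pow g x *m v) 0 0 /\
  `|(pow g x *m v) 1 0| <= 2 ^- g * (pow g x *m v) 0 0.
Proof.
move=> x0 g0 xg gap a0 ba.
have [-> ->] := mul_return v g0 gap.
have gz : g%:Z != 0 by rewrite -lt0n in g0 *; lia.
have xq : x <> q by move=> xq; move: xg; rewrite xq /Defs.q (negbTE gz).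
have kg : (k x <= g)%N by apply: (k_min gz xg).
have G0 : 0 < 2 ^+ g :> R by rewrite exprn_gt0.
have Gn : `|2 ^- g| = 2 ^- g :> R by rewrite ger0_norm ?invr_ge0 ?ltW.
rewrite normrM Gn ler_pM2l ?invr_gt0//.
have [kx|kx] := leqP (k x) 8.
  rewrite theta_0//; last by move=> []; rewrite ltnNge kx.
  rewrite cos0 sin0 !mul0r add0r !mul1r subr0.
  have G1 : 1 <= 2 ^+ g :> R by rewrite exprn_ege1// ler1n.
  have b1 : `|v 1 0| <= v 0 0.
    apply: le_trans ba _; rewrite ler_piMl ?(ltW a0)// invf_le1 ?exprn_gt0//.
    by rewrite exprn_ege1// ler1n.
  split; last by apply: le_trans b1 _; rewrite ler_peMl// ltW.
  rewrite ler_pM2r// -powR2_nat; apply: ler_powR2.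
  have := ler0n R g; lra.
rewrite theta_rot//; set e := 2 `^ (- (k x)%:R / 8).
have -> : cos (pi / 2 - e) = sin e.
  by rewrite cosD cosN sinN cos_pihalf sin_pihalf; ring.
have -> : sin (pi / 2 - e) = cos e.
  by rewrite sinD cosN sinN cos_pihalf sin_pihalf; ring.
move: ba a0; set a := v 0 0; set b := v 1 0 => ba a0.
(* The threshold 8 makes k >= 9, which gives e <= 1/2, 2^-k <= e/4 and, as
   g >= k, 2^g e/4 >= 2^(g/2): each one compares exponents of 2. *)
have k9 : 9 <= (k x)%:R :> R by rewrite ler_nat.
have kgR : (k x)%:R <= g%:R :> R by rewrite ler_nat.
have e0 : 0 < e by rewrite powR_gt0.
have e_half : e <= 2^-1.
  rewrite -[2^-1]powR_inv1//; apply: ler_powR2; lra.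
have e_loss : 2 ^- k x <= e / 4.
  have -> : 4 = 2 `^ 2%:R :> R by rewrite powR2_nat; ring.
  rewrite -powR2_nat -!powRN -powR2D; apply: ler_powR2; lra.
have e_gain : 2 `^ (g%:R / 2) <= 2 ^+ g * (e / 4).
  have -> : 4 = 2 `^ 2%:R :> R by rewrite powR2_nat; ring.
  rewrite -powR2_nat -!powRN -!powR2D; apply: ler_powR2; lra.
have g_large : 2 <= 2 `^ (g%:R / 2) :> R.
  rewrite -[leLHS]powRr1//; apply: ler_powR2; lra.
have sin_e := sin_ge_half e0 e_half.
have ca : b * cos e <= `|b|.
  by apply: le_trans (ler_norm _) _; rewrite normrM ler_piMr// cos_max.
have b_small : `|b| <= e / 4 * a by apply: le_trans ba _; rewrite ler_pM2r.
have first_ge : e / 4 * a <= sin e * a - cos e * b.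
  have : e / 2 * a <= sin e * a by rewrite ler_pM2r.
  lra.
have gain : 2 `^ (g%:R / 2) * a <= 2 ^+ g * (sin e * a - cos e * b).
  apply: (@le_trans _ _ (2 ^+ g * (e / 4) * a)); first by rewrite ler_pM2r.
  by rewrite -mulrA ler_pM2l.
split => //; apply: le_trans gain.
apply: (@le_trans _ _ (2 * a)); last by rewrite ler_pM2r.
apply: le_trans (ler_normD _ _) _; rewrite !normrM (gtr0_norm a0).
have : `|cos e| * a <= 1 * a by rewrite ler_pM2r// cos_max.
have : `|sin e| * `|b| <= 1 * `|b| by rewrite ler_wpM2r// sin_max.
have : e / 4 * a <= 1 * a by rewrite ler_pM2r//; lra.
lra.
Qed.

Lemma next_one x n : (exists m, (n < m)%N /\ x m%:Z) ->
  exists g, [/\ (0 < g)%N, x (n + g)%N%:Z & forall m, (0 < m < g)%N -> ~~ x (n + m)%N%:Z].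
Proof.
move=> [m [nm xm]].
have ex : exists g, (0 < g)%N && x (n + g)%N%:Z.
  by exists (m - n)%N; rewrite subn_gt0 nm subnKC// ltnW.
case: (ex_minnP ex) => g /andP[g0 xg] gmin.
exists g; split => // l /andP[l0 lg]; apply/negP => xl.
by have := gmin l; rewrite l0 xl leqNgt lg => /(_ isT).
Qed.

(** After the last one, if there is a last one, the diagonal matrix acts alone.
Otherwise [cone_return] is iterated from one visit to the next. The cone it
produces is contained in the one it needs next, since the one left behind at
distance g shows that k is at most g at the next visit. *)
Lemma growth x : exists p v, forall m, exists n,
  [/\ (m <= n)%N, (p <= n)%N & 2 `^ ((n - p)%N%:R / 2) <= (pow n x *m v) 0 0].
Proof.
(* The matrices are invertible, so some vector is horizontal at time p. *)
have init p : exists v, pow p x *m v = delta_mx 0 0.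
  exists (invmx (pow p x) *m delta_mx 0 0); rewrite mulmxA mulmxV ?mul1mx//.
  by rewrite unitmxE det_cocycle_pow ?unitr1//; exact: det_shift_cocycle.
have [[p xp]|inf] := pselect (exists p, forall n, (p <= n)%N -> ~~ x n%:Z).
  have [v pv] := init p; exists p, v => m; exists (p + m)%N; split; rewrite ?leq_addr ?leq_addl//.
  rewrite cocycle_powD -mulmxA pv addKn.
  have [|-> _] := @mul_pow_notV R 8 m (iter p T x) (delta_mx 0 0).
    by move=> l _; rewrite iter_shift addrC -PoszD xp// leq_addr.
  rewrite mxE !eqxx mulr1 -powR2_nat; apply: ler_powR2.
  have := ler0n R m; lra.
have {}inf n : exists m, (n < m)%N /\ x m%:Z.
  apply: contrapT => /forallNP h; apply: inf; exists n.+1 => m nm.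
  by apply/negP => xm; apply: (h m).
have [p [_ xp]] := inf 0%N.
have [v pv] := init p; exists p, v => m.
suff [n [mn pn xn wn]] : exists n, [/\ (m <= n)%N, (p <= n)%N, x n%:Z &
    2 `^ ((n - p)%N%:R / 2) <= (pow n x *m v) 0 0 /\
    `|(pow n x *m v) 1 0| <= 2 ^- k (iter n T x) * (pow n x *m v) 0 0].
  by exists n; split => //; case: wn.
elim: m => [|m [n [mn pn xn [wn0 wn1]]]].
  exists p; split => //; rewrite pv !mxE !eqxx subnn mul0r powRr0.
  by rewrite normr0 mulr1 invr_ge0 exprn_ge0.
have [g [g0 xg gap]] := next_one (inf n).
have iterE (j : nat) : iter n T x j%:Z = x (n + j)%N%:Z by rewrite iter_shift addrC -PoszD.
have [||||||w0 w1] := @cone_return (iter n T x) (pow n x *m v) g => //.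
- by rewrite iterE addn0.
- by rewrite iterE.
- by move=> l lg; rewrite iterE; exact: gap.
- by apply: lt_le_trans wn0; rewrite powR_gt0.
rewrite mulmxA -cocycle_powD in w0 w1.
exists (n + g)%N; split => //.
- by rewrite -addn1 leq_add.
- by rewrite (leq_trans pn)// leq_addr.
split.
  apply: le_trans w0; rewrite -addnBAC// natrD mulrDl powR2D mulrC.
  by rewrite ler_pM2l// powR_gt0.
apply: le_trans w1 _; rewrite ler_wpM2r//.
  apply: le_trans w0; rewrite mulr_ge0 ?powR_ge0//.
  by apply: le_trans wn0; rewrite powR_ge0.
rewrite lef_pV2 ?posrE ?exprn_gt0// ler_eXn2l ?ltr1n//.
have := @k_min R (iter (n + g) T x) (- g%:Z).
rewrite iter_shift PoszD addrC addrK => h.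
by have := h _ xn; rewrite abszN; apply; lia.
Qed.

(** As the limit is assumed to exist, large values along a sequence of times are
enough; the initial vector and the time p wash out in the limit. *)
Lemma lyapunov_exponent_ge x : cvgn (lyapunov_seq T A x) ->
  ln 2 / 2 <= lyapunov_exponent T A x.
Proof.
move=> cx; rewrite /lyapunov_exponent.
set l := limn _.
have [p [v grow]] := growth x.
pose c := p%:R / 2 * ln 2 + `|ln (enorm v)|.
apply/ler_addgt0Pr => e e0; have e2 : 0 < e / 2 by rewrite divr_gt0.
have /cvgrPdist_le /(_ _ e2) [N _ Nl] := cx.
have [M Mc] := eventually_le_mul_nat c e2.
have [n [+ pn gn]] := grow (maxn N M).+1.
case: n pn gn => // n pn gn; rewrite ltnS geq_max => /andP[Nn Mn].
have := Nl n.+1 (leqW Nn); rewrite -/l /= => ln_close.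
have := Mc n.+1 (leqW Mn) => cn.
have vg : 2 `^ ((n.+1 - p)%N%:R / 2) <= opnorm (pow n.+1 x) * enorm v.
  apply: le_trans gn _; apply: le_trans (ler_norm _) _.
  exact: le_trans (coord_le_enorm _ _) (enorm_le_opnorm _ _).
have p0 : 0 < opnorm (pow n.+1 x) * enorm v by rewrite (lt_le_trans _ vg)// powR_gt0.
have v0 : 0 < enorm v.
  by rewrite lt_def enorm_ge0 andbT; apply: contraTneq p0 => ->; rewrite mulr0 ltxx.
have o0 : 0 < opnorm (pow n.+1 x) by rewrite pmulr_lgt0 in p0.
have : (n.+1 - p)%N%:R / 2 * ln 2 <= ln (opnorm (pow n.+1 x)) + ln (enorm v).
  by rewrite -lnM ?posrE// -ln_powR ler_ln ?posrE// powR_gt0.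
rewrite natrB// => lower.
have : lyapunov_seq T A x n.+1 * n.+1%:R = ln (opnorm (pow n.+1 x)).
  by rewrite /lyapunov_seq divfK// pnatr_eq0.
move: ln_close lower cn; set s := lyapunov_seq _ _ _ _; set o := ln (opnorm _).
move=> ln_close lower cn sE.
have n0 : 0 < n.+1%:R :> R by rewrite ltr0n.
rewrite -(ler_pM2r n0).
have sl : s <= l + e / 2 by move: ln_close; rewrite distrC ler_distl => /andP[].
have := ler_wpM2r (ltW n0) sl; rewrite sE => ol.
have := ler_norm (ln (enorm v)).
move: cn; rewrite /c; lra.
Qed.

End growth.

Theorem theorem5 (R : realType) :
  exists k0 : nat, (0 < k0)%N /\
    [/\ SL2_cocycle (@shift_map R) (@shift_map_inv R) (@shift_cocycle R k0),
        ~ uniformly_hyperbolic (@shift_map R) (@shift_map_inv R) (@shift_cocycle R k0)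
      & exists S : set (fullshift R),
          [/\ full_probability R (@shift_map R) S,
              (forall x, S x ->
                 cvgn (lyapunov_seq (@shift_map R) (@shift_cocycle R k0) x) /\
                 ln 2 / 2 <= lyapunov_exponent (@shift_map R) (@shift_cocycle R k0) x)
            & 0 < ln 2 / 2 :> R]].
Proof.
exists 8%N; split => //; split.
- exact: shift_SL2_cocycle.
- exact: not_uniformly_hyperbolic.
have mT := continuous_measurable_borel_self (@shift_map_continuous R).
have mA i j : measurable_fun [set: borel_of (fullshift R)]
    (fun x : borel_of (fullshift R) => @shift_cocycle R 8 x i j).
  exact: continuous_measurable_borel (@entry_continuous R 8 i j).
have detA := @det_shift_cocycle R 8.
have AK := @entry_norm_shift_cocycle R 8.
exists [set x | cvgn (lyapunov_seq (@shift_map R) (@shift_cocycle R 8) x)]; split.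
- split; first exact: measurable_lyapunov_cvg mT mA detA AK.
  move=> mu Tmu; exact: lyapunov_cvg_ae mT mA detA AK mu Tmu.
- by move=> x cx; split => //; exact: lyapunov_exponent_ge.
- by rewrite divr_gt0// ln_gt0// ltr1n.
Qed.
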